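(* Let $\mathcal{O}$ be a one-dimensional noetherian domain whose normalization $\tilde{\mathcal{O}}$ is finitely generated over $\mathcal{O}$. Let $\mathfrak{p}_1,\dots,\mathfrak{p}_r$ be the non-invertible maximal ideals of $\mathcal{O}$, for $1\le i\le r$ let $\mathfrak{P}_{i,1},\dots,\mathfrak{P}_{i,r_i}$ be the maximal ideals of $\tilde{\mathcal{O}}$ over $\mathfrak{p}_i$, let $d_{i,j}$ be the degree of $\tilde{\mathcal{O}}/\mathfrak{P}_{i,j}$ over $\mathcal{O}/\mathfrak{p}_i$, and write $g_i:=\gcd(d_{i,1},\dots,d_{i,r_i})=\sum_{j=1}^{r_i}\lambda_{i,j}d_{i,j}$ with integers $\lambda_{i,j}$. For $1\le i\le r$ let $Q_i=\sum_{j=1}^{r_i}\lambda_{i,j}\mathfrak{P}_{i,j}\in\mathrm{Div}(\tilde{\mathcal{O}})$. Let $f_*\colon\mathrm{Div}(\tilde{\mathcal{O}})\to\mathrm{Div}(\mathcal{O})$ and $\overline{f_*}\colon\mathrm{Chow}(\tilde{\mathcal{O}})\to\mathrm{Chow}(\mathcal{O})$ be the push-forward homomorphisms. (1) The kernel of $f_*$ is generated by $\{\tfrac{d_{i,j}}{g_i}Q_i-\mathfrak{P}_{i,j}\mid 1\le i\le r,\ 1\le j\le r_i\}$. (2) Let $G=\bigoplus_{i=1}^r\mathbb{Z}\mathfrak{p}_i\oplus\mathrm{Chow}(\tilde{\mathcal{O}})/\ker(\overline{f_*})$. Then $$\varphi\colon G\to\mathrm{Chow}(\mathcal{O}),\quad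 \Bigl(\sum_{i=1}^r a_i\mathfrak{p}_i,[A]\Bigr)\mapsto\Bigl[\sum_{i=1}^r a_i\mathfrak{p}_i+f_*(A)\Bigr]$$ is a (well-defined) epimorphism with kernel $R=\langle\{(g_i\mathfrak{p}_i,[-Q_i])\in G\mid 1\le i\le r\}\rangle$. In particular, $G/R\cong\mathrm{Chow}(\mathcal{O})$.
   Context: Let $A$ be a one-dimensional noetherian domain with field of fractions $K$ whose normalization (integral closure in $K$) is finitely generated over $A$. $\mathbb{P}(A)$ is the set of maximal ideals of $A$. For $\mathfrak{p}\in\mathbb{P}(A)$, $A_\mathfrak{p}$ is the localization and $\mathrm{ord}_\mathfrak{p}\colon K^*\to\mathbb{Z}$ is the well-defined homomorphism $\frac{a}{b}\mapsto \mathrm{len}_{A_\mathfrak{p}}(A_\mathfrak{p}/aA_\mathfrak{p})-\mathrm{len}_{A_\mathfrak{p}}(A_\mathfrak{p}/bA_\mathfrak{p})$ (nonzero $a,b\in A$), where $\mathrm{len}$ is composition length. $\mathrm{Div}(A)$ is the free abelian group on $\mathbb{P}(A)$; $\mathcal{P}(A)$ is the image of $\mathrm{div}_A\colon K^*\to\mathrm{Div}(A)$, $a\mapsto\sum_{\mathfrak{p}}\mathrm{ord}_\mathfrak{p}(a)\mathfrak{p}$; $\mathrm{Chow}(A)=\mathrm{Div}(A)/\mathcal{P}(A)$. A maximal ideal is called invertible if it is invertible as a fractional ideal; $\mathcal{O}$ has only finitely many non-invertible maximal ideals. For $\mathfrak{P}\in\mathbb{P}(\tilde{\mathcal{O}})$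 and $\mathfrak{p}=\mathfrak{P}\cap\mathcal{O}\in\mathbb{P}(\mathcal{O})$, let $\deg_\mathfrak{p}(\mathfrak{P})$ be the (finite) degree of the field $\tilde{\mathcal{O}}/\mathfrak{P}$ over $\mathcal{O}/\mathfrak{p}$. The push-forward $f_*\colon\mathrm{Div}(\tilde{\mathcal{O}})\to\mathrm{Div}(\mathcal{O})$ sends $\sum_\mathfrak{P}a_\mathfrak{P}\mathfrak{P}$ to $\sum_\mathfrak{P}a_\mathfrak{P}\deg_{\mathfrak{P}\cap\mathcal{O}}(\mathfrak{P})\,(\mathfrak{P}\cap\mathcal{O})$; it satisfies $f_*(\mathrm{div}_{\tilde{\mathcal{O}}}(a))=\mathrm{div}_{\mathcal{O}}(a)$ for $a\in K^*$, hence induces $\overline{f_*}\colon\mathrm{Chow}(\tilde{\mathcal{O}})\to\mathrm{Chow}(\mathcal{O})$. In (2), $\bigoplus_i\mathbb{Z}\mathfrak{p}_i$ is the subgroup of $\mathrm{Div}(\mathcal{O})$ generated by the $\mathfrak{p}_i$, and $[A]$ denotes the class in $\mathrm{Chow}(\tilde{\mathcal{O}})/\ker(\overline{f_*})$ of a divisor $A\in\mathrm{Div}(\tilde{\mathcal{O}})$. *)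

(* Defs.v *)
From HB Require Import structures.
From mathcomp Require Import all_boot all_order all_algebra.
From mathcomp Require Import boolp classical_sets functions cardinality fsbigop.
From mathcomp Require Import freeg.

Set Implicit Arguments.
Unset Strict Implicit.
Unset Printing Implicit Defensive.

Import GRing.Theory.
Local Open Scope classical_set_scope.
Local Open Scope quotient_scope.
Local Open Scope ring_scope.

Local Notation tofrac := (@FracField.tofrac _).
Local Notation "x %:F" := (tofrac x).

Section Subgroups.
Variable V : zmodType.

Definition is_subgroup (H : set V) : Prop := zmod_closed (mem H).

Definition gen (S : set V) : set V := smallest is_subgroup S.

Definition gen_pred (S : set V) : {pred V} := mem (gen S).

Lemma gen_zmod_closed (S : set V) : zmod_closed (gen_pred S).
Proof.
split=> [|x y]; rewrite /gen_pred /= ?inE.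
  by move=> H [[+ _] _]; rewrite inE.
move=> gx gy H HS; have [[_ HB] _] := HS.
by have := HB x y; rewrite !inE; apply; [exact: gx | exact: gy].
Qed.

HB.instance Definition _ (S : set V) :=
  GRing.isZmodClosed.Build V (gen_pred S) (gen_zmod_closed S).

Lemma gen_id (H : set V) : is_subgroup H -> gen H = H.
Proof.
move=> sgH; apply/seteqP; split=> [x|x Hx K [_ HK]]; last exact: HK.
by apply; split.
Qed.

End Subgroups.

(* V / <S>, which is V / S when S is itself a subgroup (see gen_id). *)
Definition quotg (V : zmodType) (S : set V) := Quotient.quot (gen_pred S).
HB.instance Definition _ (V : zmodType) (S : set V) :=
  GRing.Zmodule.on (quotg S).
HB.instance Definition _ (V : zmodType) (S : set V) :=
  Quotient.on (quotg S).

Definition cls (V : zmodType) (S : set V) (x : V) : quotg S := \pi_(quotg S) x.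

Section SubgroupType.
Variables (V : zmodType) (S : set V).

Record subgrp := Subgrp { sg_val : V; _ : sg_val \in gen_pred S }.
HB.instance Definition _ := [isSub for sg_val].
HB.instance Definition _ := [Choice of subgrp by <:].
HB.instance Definition _ := [SubChoice_isSubZmodule of subgrp by <:].
End SubgroupType.

Definition ker (U V : zmodType) (f : U -> V) : set U := [set x | f x = 0].

Section Submodules.
Variables (R : nzRingType) (M : lmodType R).

Definition submodule (N : set M) : Prop := submod_closed (mem N).

Definition lspan (S : set M) : set M := smallest submodule S.

Definition finitely_generated (N : set M) : Prop :=
  exists s : seq M, N = lspan [set x | x \in s].

Definition lspan_pred (S : set M) : {pred M} := mem (lspan S).

Lemma lspan_submod_closed (S : set M) : submod_closed (lspan_pred S).
Proof.
split=> [|a x y]; rewrite /lspan_pred /= ?inE.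
  by move=> N [[+ _] _]; rewrite inE.
move=> sx sy N NS; have [[_ ND] _] := NS.
by have := ND a x y; rewrite !inE; apply; [exact: sx | exact: sy].
Qed.

HB.instance Definition _ (S : set M) := GRing.isZmodClosed.Build M (lspan_pred S)
  (GRing.submod_closedB (lspan_submod_closed S)).

Lemma lspan_id (N : set M) : submodule N -> lspan N = N.
Proof.
move=> smN; apply/seteqP; split=> [x|x Nx L [_ NL]]; last exact: NL.
by apply; split.
Qed.

(* The quotient of M by the submodule generated by S. *)
Definition quotm (S : set M) := Quotient.quot (lspan_pred S).
HB.instance Definition _ (S : set M) := GRing.Zmodule.on (quotm S).
HB.instance Definition _ (S : set M) := Quotient.on (quotm S).

Section Scale.
Variable S : set M.
Local Notation Q := (quotm S).

Definition qscale (a : R) (x : Q) : Q := \pi_Q (a *: repr x).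

Lemma pi_qscale a (u : M) : qscale a (\pi_Q u) = \pi_Q (a *: u).
Proof.
apply/eqP; rewrite -Quotient.idealrBE -scalerBr.
have [s0 sD] := lspan_submod_closed S.
rewrite -[_ *: _]addr0; apply: sD => //.
by rewrite Quotient.idealrBE reprK.
Qed.

Lemma pi_quotmD : {morph \pi_Q : u v / u + v}.
Proof. exact: raddfD. Qed.

Lemma qscaleA a b x : qscale a (qscale b x) = qscale (a * b) x.
Proof. by rewrite -[x]reprK (pi_qscale b) !pi_qscale scalerA. Qed.
Lemma qscale1 : left_id 1 qscale.
Proof. by move=> x; rewrite -[x]reprK pi_qscale scale1r. Qed.
Lemma qscaleDr : right_distributive qscale +%R.
Proof.
move=> a x y; rewrite -[x]reprK -[y]reprK -pi_quotmD !pi_qscale.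
by rewrite scalerDr pi_quotmD.
Qed.
Lemma qscaleDl x : {morph qscale^~ x : a b / a + b}.
Proof.
by move=> a b /=; rewrite -[x]reprK !pi_qscale scalerDl pi_quotmD.
Qed.

HB.instance Definition _ := GRing.Zmodule_isLmodule.Build R (quotm S)
  qscaleA qscale1 qscaleDr qscaleDl.
End Scale.
End Submodules.

Section Length.
Variables (R : nzRingType) (M : lmodType R).

Definition composition_series (n : nat) (N : nat -> set M) : Prop :=
  [/\ N 0%N = [set 0], N n = setT, forall i, (i <= n)%N -> submodule (N i) &
    forall i, (i < n)%N -> N i `<` N i.+1 /\
      forall L, submodule L -> N i `<=` L -> L `<=` N i.+1 ->
        L = N i \/ L = N i.+1].

(* By Jordan-Hoelder at most one n qualifies; 0 is returned if there is none. *)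
Definition len : nat := xget 0%N [set n | exists N, composition_series n N].
End Length.

Section Ideals.
Variable A : comNzRingType.
Implicit Types I J : set A.

Definition noetherian : Prop :=
  forall I : set A^o, submodule I -> finitely_generated I.

(* idealr_closed requires 1 \notin I. *)
Definition proper_ideal_set I : Prop := idealr_closed (mem I).

Definition prime_ideal I : Prop :=
  proper_ideal_set I /\ prime_idealr_closed (mem I).

Definition maximal_ideal I : Prop := proper_ideal_set I /\
  forall J, proper_ideal_set J -> I `<=` J -> J = I.

Definition prime_chain (n : nat) (C : nat -> set A) : Prop :=
  (forall i, (i <= n)%N -> prime_ideal (C i)) /\
  (forall i, (i < n)%N -> C i `<` C i.+1).

Definition krull_dim_eq (n : nat) : Prop :=
  (exists C, prime_chain n C) /\
  forall m, (exists C, prime_chain m C) -> (m <= n)%N.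

Record maxideal := MaxIdeal {
  mi_set :> set A;
  mi_maximal : maximal_ideal mi_set }.

HB.instance Definition _ := gen_eqMixin maxideal.
HB.instance Definition _ := gen_choiceMixin maxideal.

Definition mi_pred (p : maxideal) : {pred A} := mem (p : set A).

Lemma mi_pred_idealr (p : maxideal) : idealr_closed (mi_pred p).
Proof. exact: (mi_maximal p).1. Qed.

HB.instance Definition _ (p : maxideal) :=
  isIdealr.Build A (mi_pred p) (mi_pred_idealr p).

Lemma mi_bezout (p : maxideal) u :
  u \notin mi_pred p -> exists a y, y \in mi_pred p /\ a * u + y = 1.
Proof.
have [p0 p1 pD] := mi_pred_idealr p => uNp.
pose J : set A := [set x | exists a y, y \in mi_pred p /\ a * u + y = x].
have [//|J1] := pselect (J 1).
have pJ : (p : set A) `<=` J.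
  by move=> x px; exists 0, x; rewrite mul0r add0r; split=> //; apply/mem_set.
have JI : proper_ideal_set J.
  split; first by rewrite inE; exact/pJ/set_mem.
    by apply/negP; rewrite inE.
  move=> c x y; rewrite !inE => -[a [x' [x'p <-]]] [b [y' [y'p <-]]].
  exists (c * a + b), (c * x' + y'); split; first exact: pD.
  by rewrite mulrDr mulrDl mulrA addrACA.
have JE := (mi_maximal p).2 J JI pJ.
case/negP: uNp; apply/mem_set; rewrite -JE.
by exists 1, 0; rewrite mul1r addr0.
Qed.

Lemma mi_prime (p : maxideal) : prime_idealr_closed (mi_pred p).
Proof.
move=> u v uvp; have [p0 p1 pD] := mi_pred_idealr p.
have [//|/mi_bezout [a [y [yp e]]]] := boolP (u \in mi_pred p).
by rewrite -[v]mul1r -e mulrDl -mulrA pD // mulrC -[v * y]addr0 pD.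
Qed.

Definition residue (p : maxideal) := {ideal_quot (mi_pred p)}.
HB.instance Definition _ p := GRing.ComNzRing.on (residue p).
HB.instance Definition _ p := Quotient.on (residue p).

End Ideals.

Section Invertible.
Variable A : idomainType.
Local Notation K := {fraction A}.

Definition fractional_ideal (J : set K) : Prop :=
  [/\ J 0, forall (a : A) x y, J x -> J y -> J (a%:F * x + y) &
    exists2 d : A, d != 0 & forall x, J x -> range (tofrac : A -> K) (d%:F * x)].

(* The additive span of the products, that is, the finite sums of products. *)
Definition frac_mul (I J : set K) : set K :=
  gen [set z | exists x y, [/\ I x, J y & z = x * y]].

Definition invertible (p : maxideal A) : Prop := exists J : set K,
  fractional_ideal J /\ frac_mul ((tofrac : A -> K) @` p) J = range (tofrac : A -> K).
End Invertible.

Section Localization.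
Variables (A : idomainType) (p : maxideal A).
Local Notation K := {fraction A}.

Definition loc_pred : {pred K} :=
  fun x => `[< exists a s : A, s \notin mi_pred p /\ x = a%:F / s%:F >].

Lemma mi_compl_neq0 (s : A) : s \notin mi_pred p -> s%:F != 0 :> K.
Proof.
rewrite tofrac_eq0; apply: contraNneq => ->.
by have [] := mi_pred_idealr p.
Qed.

Lemma mi_compl1 : 1 \notin mi_pred p.
Proof. by have [] := mi_pred_idealr p. Qed.

Lemma mi_complM s t :
  s \notin mi_pred p -> t \notin mi_pred p -> s * t \notin mi_pred p.
Proof. by move=> ps pt; apply/negP => /mi_prime; rewrite (negPf ps) (negPf pt). Qed.

Lemma loc_subring : subring_closed loc_pred.
Proof.
split=> [|x y|x y].
- by apply/asboolP; exists 1, 1; rewrite tofrac1 divr1; split=> //; exact: mi_compl1.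
- move=> /asboolP [a [s [ps ->]]] /asboolP [b [t [pt ->]]]; apply/asboolP.
  exists (a * t - b * s), (s * t); split; first exact: mi_complM.
  rewrite tofracB !tofracM -mulNr addf_div ?mi_compl_neq0 //.
  by rewrite mulNr.
- move=> /asboolP [a [s [ps ->]]] /asboolP [b [t [pt ->]]]; apply/asboolP.
  exists (a * b), (s * t); split; first exact: mi_complM.
  by rewrite !tofracM mulf_div.
Qed.

HB.instance Definition _ := GRing.isSubringClosed.Build K loc_pred loc_subring.

Record loc := Loc { loc_val : K; _ : loc_val \in loc_pred }.
HB.instance Definition _ := [isSub for loc_val].
HB.instance Definition _ := [Choice of loc by <:].
HB.instance Definition _ := [SubChoice_isSubComNzRing of loc by <:].

Lemma to_loc_subproof (a : A) : a%:F \in loc_pred.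
Proof. by apply/asboolP; exists a, 1; rewrite tofrac1 divr1; split=> //; exact: mi_compl1. Qed.

Definition to_loc (a : A) : loc := Loc (to_loc_subproof a).

Definition len_at (a : A) : nat := len (quotm [set to_loc a : loc^o]).

(* Only meaningful for x != 0; the value does not depend on the chosen
   representation of x as a quotient. *)
Definition ord (x : K) : int :=
  (len_at \n_(repr x))%:Z - (len_at \d_(repr x))%:Z.
End Localization.

Section Divisors.
Variable A : idomainType.

Definition Div := {freeg (maxideal A)}.
HB.instance Definition _ := GRing.Lmodule.on Div.

(* The support is finite when A is noetherian of dimension one and x != 0; the
   sum over an infinite support would be 0 by convention. *)
Definition div (x : {fraction A}) : Div :=
  \sum_(p \in [set: maxideal A]) << ord p x *g p >>.

Definition principal : set Div := div @` [set x | x != 0].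

(* quotg divides by the subgroup generated by principal, which is principal
   itself because ord p is a homomorphism on the units of {fraction A}. *)
Definition Chow := quotg principal.
HB.instance Definition _ := GRing.Zmodule.on Chow.
HB.instance Definition _ := Quotient.on Chow.
End Divisors.

(* The number of elements of a k-basis of k' via f : k -> k' (0 if there is no
   finite one). *)
Definition field_degree (k k' : nzRingType) (f : k -> k') : nat :=
  xget 0%N [set n | exists b : 'I_n -> k', forall y : k',
    exists! c : {ffun 'I_n -> k}, y = \sum_i f (c i) * b i].

Section Normalization.
Variable O : idomainType.
Local Notation K := {fraction O}.

Definition int_closure : {pred K} :=
  fun x => `[< integralOver (tofrac : O -> K) x >].

Lemma int_closure_subring : subring_closed int_closure.
Proof.
split=> [|x y /asboolP ix /asboolP iy|x y /asboolP ix /asboolP iy]; apply/asboolP.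
- exact: integral1.
- exact: integral_sub.
- exact: integral_mul.
Qed.

HB.instance Definition _ :=
  GRing.isSubringClosed.Build K int_closure int_closure_subring.

Record normalization := Normalization {
  norm_val : K; _ : norm_val \in int_closure }.
HB.instance Definition _ := [isSub for norm_val].
HB.instance Definition _ := [Choice of normalization by <:].
HB.instance Definition _ := [SubChoice_isSubComNzRing of normalization by <:].

Definition norm_unit : {pred normalization} :=
  fun x => (val x != 0) && ((val x)^-1 \in int_closure).

Definition norm_inv (x : normalization) : normalization :=
  if val x == 0 then x else insubd x (val x)^-1.

Lemma norm_mulVx : {in norm_unit, left_inverse 1 norm_inv *%R}.
Proof.
move=> x /andP [x0 ix]; apply: val_inj.
by rewrite /norm_inv (negPf x0) rmorphM /= insubdK // mulVf // rmorph1.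
Qed.

Lemma norm_unitPl (x y : normalization) : y * x = 1 -> norm_unit x.
Proof.
move/(congr1 val); rewrite rmorphM rmorph1 /= => yx1.
have x0 : val x != 0.
  by apply: contra_eq_neq yx1 => ->; rewrite mulr0 eq_sym oner_neq0.
apply/andP; split=> //; suff -> : (val x)^-1 = val y by exact: valP.
by rewrite -[LHS]mul1r -yx1 mulfK.
Qed.

Lemma norm_inv_out : {in [predC norm_unit], norm_inv =1 id}.
Proof.
move=> x; rewrite inE /= /norm_inv => nu; case: ifPn => // x0.
apply: val_inj; rewrite val_insubd; case: ifPn => // ix.
by case/negP: nu; apply/andP.
Qed.

HB.instance Definition _ := GRing.ComNzRing_hasMulInverse.Build normalization
  norm_mulVx norm_unitPl norm_inv_out.

Lemma norm_idomain (x y : normalization) : x * y = 0 -> (x == 0) || (y == 0).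
Proof.
move/(congr1 val); rewrite rmorphM rmorph0 /= => /eqP.
by rewrite mulf_eq0 -!(inj_eq val_inj) !rmorph0.
Qed.

HB.instance Definition _ :=
  GRing.ComUnitRing_isIntegral.Build normalization norm_idomain.

Lemma to_norm_subproof (a : O) : a%:F \in int_closure.
Proof. by apply/asboolP; exact: integral_id. Qed.

Definition to_norm (a : O) : normalization := Normalization (to_norm_subproof a).

Lemma to_norm_zmod : zmod_morphism to_norm.
Proof. by move=> a b; apply: val_inj; rewrite [RHS]rmorphB; exact: rmorphB. Qed.
Lemma to_norm_monoid : monoid_morphism to_norm.
Proof.
split=> [|a b]; apply: val_inj; first by rewrite [RHS]rmorph1; exact: rmorph1.
by rewrite [RHS]rmorphM; exact: rmorphM.
Qed.
HB.instance Definition _ :=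
  GRing.isZmodMorphism.Build O normalization to_norm to_norm_zmod.
HB.instance Definition _ :=
  GRing.isMonoidMorphism.Build O normalization to_norm to_norm_monoid.

Definition norm_scale (a : O) (x : normalization) : normalization := to_norm a * x.
Lemma norm_scaleA a b x : norm_scale a (norm_scale b x) = norm_scale (a * b) x.
Proof. by rewrite /norm_scale rmorphM mulrA. Qed.
Lemma norm_scale1 : left_id 1 norm_scale.
Proof. by move=> x; rewrite /norm_scale rmorph1 mul1r. Qed.
Lemma norm_scaleDr : right_distributive norm_scale +%R.
Proof. by move=> a x y; rewrite /norm_scale mulrDr. Qed.
Lemma norm_scaleDl x : {morph norm_scale^~ x : a b / a + b}.
Proof. by move=> a b; rewrite /norm_scale rmorphD mulrDl. Qed.
HB.instance Definition _ := GRing.Zmodule_isLmodule.Build O normalization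
  norm_scaleA norm_scale1 norm_scaleDr norm_scaleDl.

Section Contraction.
Variable P : maxideal normalization.

Definition contraction_set : set O := to_norm @^-1` P.

Lemma contraction_proper : proper_ideal_set contraction_set.
Proof.
have [P0 P1 PD] := mi_pred_idealr P; split.
- by rewrite inE /contraction_set /= rmorph0; exact: set_mem.
- by apply: contra P1; rewrite inE /contraction_set /= rmorph1 => /mem_set.
- move=> a u v; rewrite !inE /contraction_set /= => Pu Pv.
  by rewrite rmorphD rmorphM; apply/set_mem/PD; exact/mem_set.
Qed.

Lemma norm_integral (x : normalization) :
  exists2 q : {poly O}, q \is monic & (map_poly to_norm q).[x] = 0.
Proof.
have /asboolP [q mq /rootP qx] := valP x; exists q => //.
apply: val_inj; rewrite [RHS]rmorph0 -qx -[LHS]horner_map.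
by congr (_.[_]); rewrite -map_poly_comp.
Qed.

Lemma contraction_maximal : maximal_ideal contraction_set.
Proof.
split=> [|J [J0 J1 JD] PJ]; first exact: contraction_proper.
apply/seteqP; split=> // a Ja; apply: contrapT => aP.
have /mi_bezout [b [y [yP eb]]] : to_norm a \notin mi_pred P.
  by apply/negP => /set_mem.
have [q mq qb] := norm_integral b.
pose phi : {rmorphism normalization -> residue P} := \pi_(residue P).
have phiK z : (phi z == 0) = (z \in mi_pred P).
  by rewrite -[in RHS](subr0 z) Quotient.idealrBE raddf0.
have ab : phi b * phi (to_norm a) = 1.
  have /eqP py : phi y == 0 by rewrite phiK.
  by rewrite -rmorphM -[LHS]addr0 -py -rmorphD eb rmorph1.
have [n sq] : exists n, size q = n.+1.
  by exists (size q).-1; rewrite prednK // lt0n size_poly_eq0 monic_neq0.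
have qE : \sum_(i < n.+1) to_norm q`_i * b ^+ i = 0.
  have sqn : (size (map_poly to_norm q) <= n.+1)%N by rewrite -sq; exact: size_poly.
  apply: etrans qb; rewrite (horner_coef_wide _ sqn).
  by apply: eq_bigr => i _; rewrite coef_map.
pose c := \sum_(i < n.+1) q`_i * a ^+ (n - i).
have cP : contraction_set c.
  apply/set_mem; rewrite -[_ \in _]phiK.
  suff -> : phi (to_norm c) =
      phi (to_norm a) ^+ n * phi (\sum_(i < n.+1) to_norm q`_i * b ^+ i).
    by rewrite qE rmorph0 mulr0.
  rewrite /c !rmorph_sum mulr_sumr; apply: eq_bigr => i _.
  rewrite !rmorphM !rmorphXn mulrCA; congr (_ * _).
  have le_in : (i <= n)%N by rewrite -ltnS.
  rewrite -[X in _ = _ ^+ X * _](subnK le_in) exprD -mulrA -exprMn.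
  by rewrite [_ * phi b]mulrC ab expr1n mulr1.
have lq : q`_n = 1 by move/monicP: mq; rewrite lead_coefE sq.
move/PJ/mem_set: cP; rewrite /c big_ord_recr /= subnn expr0 mulr1 lq => cJ.
case/negP: J1; rewrite -[1](addKr (\sum_(i < n) q`_i * a ^+ (n - i))).
rewrite -mulN1r; apply: (JD) => //; rewrite big_seq.
apply: (big_ind (fun x => x \in mem J)) => // [u v Ju Jv|i _].
  by rewrite -[u]mul1r; exact: JD.
rewrite -[(n - _)%N]prednK ?subn_gt0 // exprSr mulrA.
by rewrite -[_ * a]addr0; apply: (JD) => //; exact: mem_set.
Qed.

Definition contraction : maxideal O := MaxIdeal contraction_maximal.

(* The map of residue fields induced by to_norm, see res_mapE. *)
Definition res_map (x : residue contraction) : residue P :=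
  \pi_(residue P) (to_norm (repr x)).

Lemma res_mapE (a : O) :
  res_map (\pi_(residue contraction) a) = \pi_(residue P) (to_norm a).
Proof.
apply/eqP; rewrite /res_map -Quotient.idealrBE -rmorphB.
have : repr (\pi_(residue contraction) a) - a \in mi_pred contraction.
  by rewrite Quotient.idealrBE reprK.
by move/set_mem/mem_set.
Qed.

Definition res_degree : nat := field_degree res_map.
End Contraction.

Definition push_forward (D : Div normalization) : Div O :=
  \sum_(P <- dom D) << coeff P D * (res_degree P)%:Z *g contraction P >>.
End Normalization.

(* Main.v *)
From HB Require Import structures.
Require Import Defs.
From mathcomp Require Import all_boot all_order all_algebra.
From mathcomp Require Import boolp classical_sets functions cardinality fsbigop.
From mathcomp Require Import freeg.

(** The proof replaces lengths by divisors.  Give a simple module over a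
    domain [A] the maximal ideal annihilating it; then a module of finite
    length has a divisor, the sum of these ideals over its composition factors,
    which is well defined by the Jordan-Hoelder theorem and additive in short
    exact sequences.  When [A] is noetherian of dimension one and [a <> 0], the
    module [A / aA] has finite length: every nonzero quotient of it contains an
    element whose annihilator is prime and contains [a], so that this annihilator
    is maximal and the element spans a simple submodule ([associated_maximal],
    [exists_series]).  Localizing at [p] keeps exactly the factors [A / p]
    ([localized_series]), so the coefficients of the divisor of [A / aA] are the
    local lengths that define [ord] ([len_atE]); in particular almost all of
    these vanish, and [div] is given by such divisors ([div_fraction]).

    Compatibility of the push-forward with [div] becomes a comparison of two
    divisors.  A simple module over the normalization with annihilator [P] is,
    over [O], a vector space over the residue field of the contraction [p] of
    dimension the residue degree of [P], so the push-forward computes the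
    divisor over [O] of a module over the normalization ([push_cycle]).  For
    [a] in [O], the normalization modulo [a] and [O] modulo [a] have the same
    divisor over [O], since multiplication by [a] identifies the normalization
    modulo [O] with its image ([push_divisor_to_norm]).  Finite generation of
    the normalization makes this quotient have finite length: a common
    denominator embeds the normalization as an ideal of [O]
    ([norm_finite_length]).  Quotients of such [a] exhaust the common fraction
    field, so principal divisors are exactly the push-forwards of principal
    divisors ([range_push_principal]).

    An invertible [p] has a local equation [t], of order one at [p].  By the
    above this order is the sum of the positive integers
    [res_degree P * ord_P t] over the [P] above [p], so there is exactly one
    such [P], of degree one ([invertible_fibre]): away from the non-invertible
    ideals the push-forward is an isomorphism.  Hence a divisor whose
    push-forward lives on the [p i] is a combination of the [P i j], and modulo
    the differences [(d i j / g i) Q i - P i j], which the push-forward kills,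
    it is a combination [sum_i m i * Q i], with push-forward
    [sum_i m i * g i * p i] ([kernel_reduction]).  If the push-forward is zero,
    then so is each [m i * Q i], which determines the kernel of the push-forward.
    If [a + f_*(A)] is principal, it is [f_*(E)] for a principal [E], and the
    reduction of [A - E] writes the class of [(a, A)] as a combination of the
    stated relations; surjectivity follows from the isomorphism away from the
    [p i], and the last assertion from the isomorphism theorem. *)

Set Implicit Arguments.
Unset Strict Implicit.
Unset Printing Implicit Defensive.

Import GRing.Theory.
Local Open Scope classical_set_scope.
Local Open Scope ring_scope.

Local Notation tofrac := (@FracField.tofrac _).

(** * Composition series weighted by annihilators *)

Section Modules.
Variables (R : nzRingType) (M : lmodType R).
Implicit Types N L B C D : set M.

Lemma submoduleP N :
  submodule N <-> N 0 /\ forall a x y, N x -> N y -> N (a *: x + y).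
Proof.
split=> [[N0 ND]|[N0 ND]]; split.
- exact/set_mem.
- by move=> a x y Nx Ny; apply/set_mem/ND; exact/mem_set.
- exact/mem_set.
- by move=> a x y /set_mem Nx /set_mem Ny; apply/mem_set/ND.
Qed.

Lemma sub0 N : submodule N -> N 0.
Proof. by case/submoduleP. Qed.

Lemma subZD N a x y : submodule N -> N x -> N y -> N (a *: x + y).
Proof. by case/submoduleP => _; apply. Qed.

Lemma subD N x y : submodule N -> N x -> N y -> N (x + y).
Proof. by move=> sN Nx Ny; rewrite -[x]scale1r; exact: subZD. Qed.

Lemma subZ N a x : submodule N -> N x -> N (a *: x).
Proof. by move=> sN Nx; rewrite -[_ *: _]addr0; apply: subZD => //; exact: sub0. Qed.

Lemma subN N x : submodule N -> N x -> N (- x).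
Proof. by move=> sN Nx; rewrite -scaleN1r; exact: subZ. Qed.

Lemma subB N x y : submodule N -> N x -> N y -> N (x - y).
Proof. by move=> sN Nx Ny; apply: subD => //; exact: subN. Qed.

Lemma submodule0 : submodule [set 0 : M].
Proof.
by apply/submoduleP; split=> // a x y /= -> ->; rewrite scaler0 addr0.
Qed.

Lemma submoduleT : submodule [set: M].
Proof. exact/submoduleP. Qed.

Lemma submoduleI N L : submodule N -> submodule L -> submodule (N `&` L).
Proof.
move=> sN sL; apply/submoduleP; split; first by split; exact: sub0.
by move=> a x y [Nx Lx] [Ny Ly]; split; exact: subZD.
Qed.

Definition addm N L : set M := [set x + y | x in N & y in L].

Lemma submodule_addm N L : submodule N -> submodule L -> submodule (addm N L).
Proof.
move=> sN sL; apply/submoduleP; split.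
  by exists 0; [exact: sub0|exists 0; [exact: sub0|rewrite addr0]].
move=> a _ _ [x Nx [y Ly <-]] [x' Nx' [y' Ly' <-]].
exists (a *: x + x'); first exact: subZD.
exists (a *: y + y'); first exact: subZD.
by rewrite scalerDr addrACA.
Qed.

Lemma addm_subl N L : submodule L -> N `<=` addm N L.
Proof. by move=> sL x Nx; exists x => //; exists 0; [exact: sub0|rewrite addr0]. Qed.

Lemma addm_subr N L : submodule N -> L `<=` addm N L.
Proof. by move=> sN x Lx; exists 0; [exact: sub0|exists x => //; rewrite add0r]. Qed.

Lemma addm_lub N L D : submodule D -> N `<=` D -> L `<=` D -> addm N L `<=` D.
Proof. by move=> sD ND LD _ [x /ND Dx [y /LD Dy <-]]; exact: subD. Qed.

Definition ann N N' : set R := [set a | forall x, N' x -> N (a *: x)].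

(** Equivalently, [N' / N] is a simple module. *)
Definition covers N N' : Prop :=
  [/\ submodule N, submodule N', N `<` N' &
    forall L, submodule L -> N `<=` L -> L `<=` N' -> L = N \/ L = N'].

Lemma cover_addm N N' L : covers N N' -> submodule L -> L `<=` N' ->
  ~ (L `<=` N) -> addm N L = N'.
Proof.
move=> [sN sN' [NN' _] cN] sL LN' LN.
have [|||NE|//] := cN (addm N L); first exact: submodule_addm.
- exact: addm_subl.
- exact: addm_lub.
by case: LN; rewrite -NE; exact: addm_subr.
Qed.

(** One half of the second isomorphism theorem: [B / (B ∩ C)] is isomorphic
    to [(B + C) / C], hence as simple as the latter. *)
Lemma cover_meet C N' B : covers C N' -> submodule B -> B `<=` N' ->
  ~ (B `<=` C) -> covers (B `&` C) B /\ ann (B `&` C) B = ann C N'.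
Proof.
move=> cC sB BN' BC; have [sC sN' [CN' _] _] := cC.
have N'E := cover_addm cC sB BN' BC.
split.
  split=> //; first exact: submoduleI.
    split=> [x []//|h]; apply: BC => x /h; by case.
  move=> X sX IX XB; have [XC|XC] := pselect (X `<=` C).
    by left; apply/seteqP; split=> // x Xx; split; [exact: XB|exact: XC].
  right; apply/seteqP; split=> // b Bb.
  have : addm C X b.
    by rewrite (cover_addm cC sX _ XC); [exact: BN'|exact: subset_trans XB BN'].
  move=> [c Cc [x Xx bE]]; rewrite -bE; apply: subD => //; apply: IX; split=> //.
  by rewrite -[c](addrK x) bE; apply: subB => //; exact: XB.
apply/seteqP; split=> a h.
  rewrite -N'E => _ [c Cc [b Bb <-]]; rewrite scalerDr.
  by apply: subD; [|exact: subZ|case: (h _ Bb)].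
by move=> x Bx; split; [exact: subZ|apply/h/BN'].
Qed.

Lemma submodule_cyclic (x : M) : submodule (range (fun a => a *: x)).
Proof.
apply/submoduleP; split; first by exists 0 => //; rewrite scale0r.
move=> a _ _ [b _ <-] [c _ <-]; exists (a * b + c) => //.
by rewrite scalerDl scalerA.
Qed.

(** The quotient is a cyclic module killed by [m], in which every element
    outside [m] is invertible modulo [m]: a residue field. *)
Lemma cover_span N x (m : set R) :
  submodule N -> ~ N x ->
  (forall a, ~ m a -> exists b, m (1 - b * a)) ->
  (forall a, m a -> N (a *: x)) ->
  covers N (addm N (range (fun a => a *: x))).
Proof.
move=> sN Nx mmax mx.
have sX := submodule_cyclic x.
split=> //; first exact: submodule_addm.
  split; first exact: addm_subl.
  move=> h; apply: Nx; apply: h; apply: addm_subr => //.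
  by exists 1 => //; rewrite scale1r.
move=> L sL NL LX; have [LN|] := pselect (L `<=` N).
  by left; apply/seteqP.
move=> /existsNP [y /not_implyP [Ly Ny]]; right; apply/seteqP; split=> //.
apply: addm_lub => //.
have [n Nn [_ [a _ <-] yE]] := LX _ Ly.
have [b mb] : exists b, m (1 - b * a).
  apply: mmax => ma; apply: Ny; rewrite -yE; apply: subD => //; exact: mx.
suff Lx : L x by move=> _ [c _ <-]; exact: subZ.
have -> : x = b *: y - b *: n + (1 - b * a) *: x.
  by rewrite -yE scalerDr [_ - b *: n]addrAC subrr add0r scalerA -scalerDl addrC subrK scale1r.
apply: subD => //; last by apply/NL/mx.
by apply: subB => //; apply: subZ => //; exact: NL.
Qed.

End Modules.

Section Series.
Variables (R : nzRingType) (V : nmodType) (h : set R -> V).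

(** The weight [v] sees a composition factor only through its annihilator.
    Over a commutative ring the annihilator determines a simple module, so a
    suitable [h] counts the factors of each isomorphism type. *)
Inductive series (M : lmodType R) (N : set M) : nat -> set M -> V -> Prop :=
| series_refl : submodule N -> series N 0%N N 0
| series_step n L L' v : series N n L v -> covers L L' ->
    series N n.+1 L' (v + h (ann L L')).

Section OneModule.
Variable M : lmodType R.
Implicit Types N L B C D : set M.

Lemma seriesP N1 n N2 v : series N1 n N2 v ->
  [/\ submodule N1, submodule N2 & N1 `<=` N2].
Proof.
elim=> [sN|{}n L L' {}v _ [s1 sL N1L] [_ sL' [LL' _] _]]; first by split.
by split=> //; exact: subset_trans LL'.
Qed.

Lemma series1 N L : covers N L -> series N 1 L (h (ann N L)).
Proof.
move=> cNL; rewrite -[h _]add0r; apply: series_step => //.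
by apply: series_refl; case: cNL.
Qed.

Lemma series_cat N1 n N2 v m N3 w :
  series N1 n N2 v -> series N2 m N3 w -> series N1 (n + m) N3 (v + w).
Proof.
move=> s12; elim=> [_|{}m L L' {}w _ IH cL]; first by rewrite addn0 addr0.
by rewrite addnS addrA; exact: series_step.
Qed.

Lemma series0 N n L v : series N n L v -> n = 0%N -> N = L /\ v = 0.
Proof. by case. Qed.

Lemma seriesS N n L v : series N n L v -> forall k, n = k.+1 -> exists L' v',
  [/\ series N k L' v', covers L' L & v = v' + h (ann L' L)].
Proof. by case=> // {}n L' {}L {}v sL c k [<-]; exists L', v. Qed.

End OneModule.

(** Transport along [L ↦ N + f(L)]: on the interval from [L1] to [L2] the map
    induced by [f] modulo [N] is injective modulo [L1], so it is an isomorphism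
    of the quotients.  The cases used are injective [f], quotient maps, and
    [f] the identity (the second isomorphism theorem). *)
Section Map.
Variables (M M' : lmodType R) (f : {linear M -> M'}) (N : set M').
Hypothesis sN : submodule N.
Local Notation F L := (addm N (f @` L)).

Lemma submodule_image (L : set M) : submodule L -> submodule (f @` L).
Proof.
move=> sL; apply/submoduleP; split.
  by exists 0; [exact: sub0|rewrite raddf0].
move=> a _ _ [x Lx <-] [y Ly <-]; exists (a *: x + y); first exact: subZD.
by rewrite linearP.
Qed.

Lemma cover_map L L' : covers L L' -> L' `&` f @^-1` N `<=` L ->
  covers (F L) (F L') /\ ann (F L) (F L') = ann L L'.
Proof.
move=> [sL sL' [LL' L'L] cL] fN.
have sFL := submodule_addm sN (submodule_image sL).
have sFL' := submodule_addm sN (submodule_image sL').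
have FI x : L' x -> F L (f x) -> L x.
  move=> L'x [y Ny [_ [z Lz <-] /esym/eqP]]; rewrite -subr_eq -raddfB => /eqP fE.
  rewrite -[x](subrK z); apply: subD => //; apply: fN; split.
    by apply: subB => //; exact: LL'.
  by rewrite /= fE.
have FLL' : F L `<=` F L'.
  apply: addm_lub => //; first by apply: addm_subl; exact: submodule_image.
  move=> _ [x Lx <-]; apply: addm_subr => //; exists x => //; exact: LL'.
split.
  split=> //.
    split=> // hF; apply: L'L => x L'x; apply: FI => //; apply: hF.
    by apply: addm_subr => //; exists x.
  move=> X sX FX XF; pose Y := L' `&` f @^-1` X.
  have sY : submodule Y.
    apply: submoduleI => //; apply/submoduleP; split; first by rewrite /= raddf0; exact: sub0.
    by move=> a x y Xx Xy; rewrite /= linearP; exact: subZD.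
  have NX : N `<=` X.
    by move=> x Nx; apply/FX/addm_subl => //; exact: submodule_image.
  have XE : X = F Y.
    apply/seteqP; split; last by apply: addm_lub => // _ [x [_ Xx] <-].
    move=> x Xx; have [n Nn [_ [l L'l <-] xE]] := XF _ Xx.
    exists n => //; exists (f l) => //; exists l => //; split=> //=.
    by rewrite -[f l](addKr n) xE addrC; apply: subB => //; exact: NX.
  have LY : L `<=` Y.
    move=> x Lx; split; first exact: LL'.
    by apply/FX/addm_subr => //; exists x.
  by rewrite XE; case: (cL Y sY LY) => [x []//|->|->]; [left|right].
apply/seteqP; split=> a ha.
  move=> x L'x; apply: FI; first exact: subZ.
  by rewrite linearZ; apply: ha; apply: addm_subr => //; exists x.
move=> _ [n Nn [_ [x L'x <-] <-]]; rewrite scalerDr -linearZ.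
exists (a *: n); first exact: subZ.
by exists (f (a *: x)) => //; exists (a *: x) => //; exact: ha.
Qed.

Lemma series_map L1 n L2 v : series L1 n L2 v -> L2 `&` f @^-1` N `<=` L1 ->
  series (F L1) n (F L2) v.
Proof.
elim=> [s1 _|{}n L L' {}v sL IH cL fN].
  apply: series_refl; apply: submodule_addm => //; exact: submodule_image.
have [_ sL' [LL' _] _] := cL; have [_ _ L1L] := seriesP sL.
have [cF <-] : covers (F L) (F L') /\ ann (F L) (F L') = ann L L'.
  by apply: cover_map => //; exact: subset_trans L1L.
by apply: series_step => //; apply: IH => x [Lx Nx]; apply: fN; split=> //; exact: LL'.
Qed.

End Map.

Lemma series_image (M M' : lmodType R) (f : {linear M -> M'}) L1 n L2 v :
  injective f -> series L1 n L2 v -> series (f @` L1) n (f @` L2) v.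
Proof.
move=> fI s12.
have add0 (X : set M') : addm [set 0] X = X.
  apply/seteqP; split=> [_ [_ -> [x Xx <-]]|x Xx]; first by rewrite add0r.
  by exists 0 => //; exists x => //; rewrite add0r.
rewrite -[f @` L1]add0 -[f @` L2]add0; apply: series_map => //.
  exact: submodule0.
move=> x [_ /= fx]; have -> : x = 0 by apply: fI; rewrite fx raddf0.
by have [s1 _ _] := seriesP s12; exact: sub0.
Qed.

Section JordanHoelder.
Variable M : lmodType R.
Implicit Types N L B C D : set M.

(** Intersecting the series with [D] gives the lower half, adding [D] to it
    gives the upper half. *)
Lemma series_interval N1 n N2 v D : series N1 n N2 v -> submodule D ->
  N1 `<=` D -> D `<=` N2 -> exists n1 v1 n2 v2,
  series N1 n1 D v1 /\ series D n2 N2 v2.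
Proof.
move=> s12; elim: s12 D => [s1 D sD N1D DN1|{}n L L' {}v sL IH cL D sD N1D DL'].
  have -> : D = N1 by apply/seteqP.
  by exists 0%N, 0, 0%N, 0; split; exact: series_refl.
have [_ sLL _ ] := seriesP sL.
have [DL|DL] := pselect (D `<=` L).
  have [n1 [v1 [n2 [v2 [sa sb]]]]] := IH D sD N1D DL.
  by exists n1, v1, n2.+1, (v2 + h (ann L L')); split=> //; exact: series_step.
have [_ _ N1L] := seriesP sL.
have [||x []//|n1 [v1 [n2 [v2 [sa sb]]]]] := IH (D `&` L).
- exact: submoduleI.
- by move=> x Nx; split; [exact: N1D|exact: N1L].
have [cI _] := cover_meet cL sD DL' DL.
exists n1.+1, (v1 + h (ann (D `&` L) D)), n2, v2; split; first exact: series_step.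
have := @series_map _ _ (idfun : {linear M -> M}) D sD _ _ _ _ sb.
have id_image (X : set M) : idfun @` X = X by rewrite image_id.
rewrite !id_image => /(_ _).
have -> : addm D (D `&` L) = D.
  apply/seteqP; split; last by apply: addm_subl; exact: submoduleI.
  by apply: addm_lub => // x [].
have -> : addm D L = L'.
  rewrite -(cover_addm cL sD DL' DL); apply/seteqP.
  by split=> _ [x Dx [y Ly <-]]; exists y => //; exists x => //; rewrite addrC.
by apply; move=> x [].
Qed.

(** If the last terms [B] and [C] below the top differ, both series are
    compared with series through [B `&` C], where the two top factors occur in
    the opposite order. *)
Theorem Jordan_Hoelder N1 n N2 v m w :
  series N1 n N2 v -> series N1 m N2 w -> n = m /\ v = w.
Proof.
elim: n N2 v m w => [|n IH] N2 v m w sv sw.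
  have [E ->] := series0 sv erefl; rewrite -{}E in sw.
  case: m sw => [|m] sw; first by have [_ ->] := series0 sw erefl.
  have [L' [v' [/seriesP [_ _ NL] [_ _ [_ h1] _] _]]] := seriesS sw erefl.
  by case: h1.
have [B [vB [sB cB ->]]] := seriesS sv erefl.
case: m sw => [|m] sw.
  have [E _] := series0 sw erefl; case: cB => _ _ [_ []].
  by have [_ _] := seriesP sB; rewrite E.
have [C [vC [sC cC ->]]] := seriesS sw erefl.
have [BC|BC] := pselect (B = C).
  by rewrite -{}BC in sC cC *; have [-> ->] := IH _ _ _ _ sB sC.
have [ssB _ [BN _] mB] := cB; have [ssC _ [CN CN'] mC] := cC.
have nBC : ~ (B `<=` C).
  move=> h1; case: (mB C ssC h1 CN) => [/esym//|E]; case: CN'; rewrite E.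
  by [].
have nCB : ~ (C `<=` B).
  move=> h1; case: (mC B ssB h1 BN) => [//|E].
  by case: cB => _ _ [_ []]; rewrite E.
have [c1 a1] := cover_meet cC ssB BN nBC.
have [c2 a2] := cover_meet cB ssC CN nCB.
rewrite setIC in c2 a2.
have [_ _ N1B] := seriesP sB; have [_ _ N1C] := seriesP sC.
have [||x []//|k [u [_ [_ [sD _]]]]] := series_interval sB (D := B `&` C).
- exact: submoduleI.
- by move=> x Nx; split; [exact: N1B|exact: N1C].
have [nk ->] := IH _ _ _ _ sB (series_step sD c1).
rewrite nk in IH.
have [<- <-] := IH _ _ _ _ (series_step sD c2) sC.
by rewrite nk a1 a2 addrAC.
Qed.

(** The number of steps below [L] ranks the submodules [L] in the interval. *)
Lemma series_rank N1 n N2 v : series N1 n N2 v ->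
  exists rho : set M -> nat, forall L L', submodule L -> submodule L' ->
    N1 `<=` L -> L `<` L' -> L' `<=` N2 -> (rho L < rho L')%N.
Proof.
move=> s12; pose rho L := xget 0%N [set k | exists w, series N1 k L w].
have rhoE L k w : series N1 k L w -> rho L = k.
  move=> sL; apply: xget_unique; first by exists w.
  by move=> k' [w' sL']; have [] := Jordan_Hoelder sL' sL.
exists rho => L L' sL sL' N1L [LL' L'L] L'N2.
have N1L' := subset_trans N1L LL'.
have [k' [w' [_ [_ [s1 _]]]]] := series_interval s12 sL' N1L' L'N2.
have [k [w [m [u [s2 s3]]]]] := series_interval s1 sL N1L LL'.
rewrite (rhoE _ _ _ s2) (rhoE _ _ _ (series_cat s2 s3)) -addn1 leq_add2l lt0n.
by apply/eqP => /(series0 s3) [E _]; apply: L'L; rewrite E.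
Qed.

(** A strictly increasing rank function on an interval of submodules bounds
    the chains in it, so refining a chain as long as possible ends in a
    composition series. *)
Lemma series_of_rank N1 N2 (rho : set M -> nat) :
  submodule N1 -> submodule N2 -> N1 `<=` N2 ->
  (forall L L', submodule L -> submodule L' -> N1 `<=` L -> L `<` L' ->
    L' `<=` N2 -> (rho L < rho L')%N) ->
  exists n v, series N1 n N2 v.
Proof.
move=> s1; have [k] := ubnP (rho N2 - rho N1)%N.
elim: k N1 N2 s1 => // k IH N1 N2 s1; rewrite ltnS => kE s2 N12 hr.
have [E|E] := pselect (N1 = N2).
  by rewrite -E; exists 0%N, 0; exact: series_refl.
have P12 : N1 `<` N2 by split=> // h1; apply: E; apply/seteqP.
have r12 := hr _ _ s1 s2 (@subset_refl _ _) P12 (@subset_refl _ _).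
have [c|] := pselect (covers N1 N2); first by exists 1%N, (h (ann N1 N2)); exact: series1.
move=> nc; have [L [sL [N1L LN2]]] : exists L, submodule L /\ N1 `<` L /\ L `<` N2.
  apply: contrapT => nL; apply: nc; split=> // L sL N1L LN2.
  have [LN1|LN1] := pselect (L `<=` N1); first by left; apply/seteqP.
  have [N2L|N2L] := pselect (N2 `<=` L); first by right; apply/seteqP.
  by case: nL; exists L.
have r1 := hr _ _ s1 sL (@subset_refl _ _) N1L LN2.1.
have r2 := hr _ _ sL s2 N1L.1 LN2 (@subset_refl _ _).
have [|L1 L2 ? ? ? ? L2L|n1 [v1 sr1]] := IH N1 L s1 _ sL N1L.1.
- by apply: leq_trans kE; apply: ltn_sub2r.
- by apply: hr => //; exact: subset_trans LN2.1.
have [|L1 L2 ? ? LL1 ? ?|n2 [v2 sr2]] := IH L N2 sL _ s2 LN2.1.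
- by apply: leq_trans kE; apply: ltn_sub2l.
- by apply: hr => //; exact: subset_trans N1L.1 LL1.
by exists (n1 + n2)%N, (v1 + v2); exact: series_cat sr1 sr2.
Qed.

End JordanHoelder.

Lemma series_preimage (M M' : lmodType R) (f : {linear M -> M'}) N1 N2 n v :
  injective f -> submodule N1 -> submodule N2 -> N1 `<=` N2 ->
  series (f @` N1) n (f @` N2) v -> exists m w, series N1 m N2 w.
Proof.
move=> fI s1 s2 N12 /series_rank [rho rhoP].
apply: (@series_of_rank _ _ _ (fun L => rho (f @` L))) => // L L' sL sL' N1L [LL' L'L] L'N2.
apply: rhoP; [exact: submodule_image|exact: submodule_image|exact: image_subset| |
  exact: image_subset].
split; first exact: image_subset.
by move=> h1; apply: L'L => x /(imageP f) /h1 [y Ly /fI <-].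
Qed.

End Series.

Section CompositionLength.
Variables (R : nzRingType) (M : lmodType R).

Lemma composition_of_series n (N N' : set M) (V : nmodType) (h : set R -> V) v :
  series h N n N' v -> exists F : nat -> set M,
  [/\ F 0%N = N, F n = N', forall i, (i <= n)%N -> submodule (F i) &
    forall i, (i < n)%N -> covers (F i) (F i.+1)].
Proof.
elim=> [sN|{}n L L' {}v _ [F [F0 Fn sF cF]] cL].
  by exists (fun=> N); split.
have [_ sL' _ _] := cL; exists (fun i => if (i <= n)%N then F i else L').
split=> [||i|i]; rewrite ?ltnS ?ltnn // => le_in.
- by case: ifP => // in_; exact: sF.
- rewrite le_in; case: ifP => [|]; first exact: cF.
  move/negbT; rewrite -ltnNge ltnS => ge_in.
  by have -> : i = n; [apply/eqP; rewrite eqn_leq le_in|rewrite Fn].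
Qed.

Lemma series_of_composition n (N : nat -> set M) (V : nmodType) (h : set R -> V) :
  composition_series n N ->
  exists v, series h [set 0] n [set: M] v.
Proof.
move=> [N0 <- sN cN].
suff H k : (k <= n)%N -> exists v, series h [set 0] k (N k) v by exact: H.
elim: k => [_|k IH kn]; first by exists 0; rewrite N0; apply/series_refl/submodule0.
have [v sv] := IH (ltnW kn); exists (v + h (ann (N k) (N k.+1))).
apply: series_step => //; have [? ?] := cN _ kn.
by split=> //; apply: sN => //; exact: ltnW.
Qed.

Lemma len_series n (V : nmodType) (h : set R -> V) v :
  series h [set 0] n [set: M] v -> len M = n.
Proof.
move=> sn; apply: xget_unique.
  have [F [F0 Fn sF cF]] := composition_of_series sn.
  by exists F; split=> // i /cF [].
move=> m [N /(series_of_composition h) [w sm]].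
by have [-> _] := Jordan_Hoelder sm sn.
Qed.

End CompositionLength.

(** * Maximal ideals as annihilators of simple modules *)

Section CommutativeRing.
Variable A : comNzRingType.

Lemma proper_idealP (I : set A) : proper_ideal_set I <->
  submodule (I : set A^o) /\ ~ I 1.
Proof.
split=> [[I0 I1 ID]|[/submoduleP [I0 ID] I1]].
  by split; [split|move/mem_set; exact/negP].
split; [exact: mem_set|by apply/negP => /set_mem|].
by move=> a x y /set_mem Ix /set_mem Iy; apply/mem_set/ID.
Qed.

Lemma mi_submodule (p : maxideal A) : submodule (p : set A^o).
Proof. by have /proper_idealP [] := (mi_maximal p).1. Qed.

Lemma mi_not1 (p : maxideal A) : ~ (p : set A) 1.
Proof. by have /proper_idealP [] := (mi_maximal p).1. Qed.

Lemma mi_inj : injective (@mi_set A).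
Proof.
by move=> [p pm] [q qm] /= E; case: q / E qm => qm; congr MaxIdeal; exact: Prop_irrelevance.
Qed.

Lemma mi_sub_eq (p q : maxideal A) : (p : set A) `<=` q -> p = q.
Proof.
move=> pq; apply: mi_inj; apply/esym.
by apply: (mi_maximal p).2 => //; exact: (mi_maximal q).1.
Qed.

Lemma mi_neq (p q : maxideal A) : p <> q -> exists2 s, (p : set A) s & ~ (q : set A) s.
Proof.
move=> pq; apply: contrapT => h; apply/pq/mi_sub_eq => s ps.
by apply: contrapT => qs; apply: h; exists s.
Qed.

Lemma mi_inverse (p : maxideal A) a : ~ (p : set A) a ->
  exists b, (p : set A) (1 - b * a).
Proof.
move=> pa; have /mi_bezout [b [y [py <-]]] : a \notin mi_pred p.
  by apply/negP => /set_mem.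
by exists b; rewrite addrAC subrr add0r; exact: set_mem.
Qed.

Lemma mi_mul (p : maxideal A) a b : (p : set A) (a * b) -> (p : set A) a \/ (p : set A) b.
Proof.
move=> /mem_set pab; have /orP [] := mi_prime (p := p) pab; move/set_mem; by [left|right].
Qed.

Variable M : lmodType A.
Implicit Types N : set M.

Lemma cover_cyclic N N' x : covers N N' -> N' x -> ~ N x ->
  addm N (range (fun a : A => a *: x)) = N'.
Proof.
move=> cN N'x Nx; have [_ sN' _ _] := cN.
apply: (cover_addm cN (submodule_cyclic x)).
  by move=> _ [a _ <-]; exact: subZ.
by apply: contra_not Nx; apply; exists 1 => //; rewrite scale1r.
Qed.

Lemma cover_new N N' : covers N N' -> exists2 x, N' x & ~ N x.
Proof.
by move=> [_ _ [_ /existsNP [x /not_implyP [N'x Nx]]] _]; exists x.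
Qed.

(** [N' / N] is generated by the class of [x], so over a commutative ring what
    kills this class kills everything. *)
Lemma ann_cyclic N N' x a : covers N N' -> N' x -> ~ N x ->
  N (a *: x) -> ann N N' a.
Proof.
move=> cN N'x Nx Na; have [sN _ _ _] := cN.
rewrite /ann /= -(cover_cyclic cN N'x Nx) => _ [n Nn [_ [b _ <-] <-]].
by rewrite scalerDr scalerA mulrC -scalerA; apply: subD => //; exact: subZ.
Qed.

Lemma ann_cover N N' : covers N N' -> maximal_ideal (ann N N').
Proof.
move=> cN; have [sN sN' _ _] := cN; have [x N'x Nx] := cover_new cN.
have pI : proper_ideal_set (ann N N').
  apply/proper_idealP; split; last by move/(_ _ N'x); rewrite scale1r.
  apply/submoduleP; split=> [y _|a b c hb hc y N'y].
    by rewrite scale0r; exact: sub0.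
  by rewrite scalerDl -scalerA; apply: subZD; [|exact: hb|exact: hc].
split=> // J /proper_idealP [sJ J1] IJ; apply/seteqP; split=> // a Ja.
apply: contrapT => /(contra_not (@ann_cyclic _ _ _ a cN N'x Nx)) Nax.
have := N'x; rewrite -(cover_cyclic cN _ Nax); last exact: subZ.
move=> [n Nn [_ [b _ <-] xE]]; apply: J1.
rewrite -[1](subrK (b * a)); apply: (@subD _ A^o) => //; last exact: (@subZ _ A^o).
apply/IJ/(ann_cyclic cN N'x Nx); rewrite scalerBl scale1r -scalerA -{1}xE.
by rewrite addrK.
Qed.

Definition cover_mi N N' (cN : covers N N') : maxideal A := MaxIdeal (ann_cover cN).

Lemma ann_eq N N' (p : maxideal A) : covers N N' -> (p : set A) `<=` ann N N' ->
  ann N N' = p.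
Proof. by move=> cN; apply: (mi_maximal p).2; have [] := ann_cover cN. Qed.

End CommutativeRing.

(** * Finite length over one-dimensional noetherian domains *)

Section NoetherianDomain.
Variable A : idomainType.

Lemma noetherian_max (F : set (set A^o)) : noetherian A ->
  (exists I, F I) -> (forall I, F I -> submodule I) ->
  exists2 I, F I & forall J, F J -> I `<=` J -> J = I.
Proof.
move=> noeth [I0 FI0] sF; apply: contrapT => nF.
have next (I : set A^o) : exists J, F I -> F J /\ I `<` J.
  have [FI|FI] := pselect (F I); last by exists I.
  apply: contrapT => nJ; apply: nF; exists I => // J FJ IJ.
  apply/seteqP; split=> //; apply: contrapT => JI; apply: nJ.
  by exists J => _; split.
have [g gP] := choice next.
pose C n := iter n g I0.
have FC n : F (C n) by elim: n => //= n /gP [].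
have CS n : C n `<` C n.+1 by have [] := gP _ (FC n).
have Cmono m n : (m <= n)%N -> C m `<=` C n.
  move/subnK <-; elim: (n - m)%N => // k IH.
  by apply: subset_trans IH _; rewrite addSn; exact: (CS _).1.
pose U : set A^o := \bigcup_n C n.
have sU : submodule U.
  apply/submoduleP; split; first by exists 0%N => //; apply: sub0; exact: sF.
  move=> a x y [m _ Cx] [n _ Cy]; exists (maxn m n) => //.
  apply: subZD; first exact/sF.
    by apply: Cmono Cx; exact: leq_maxl.
  by apply: Cmono Cy; exact: leq_maxr.
have [s UE] := noeth _ sU.
have [n sn] : exists n, forall x, x \in s -> C n x.
  have : forall x, x \in s -> U x.
    by move=> x xs; rewrite UE => L [_]; apply.
  elim: s {UE} => [|x s IH] hs; first by exists 0%N.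
  have [n nP] := IH (fun y ys => hs y (mem_behead (s := x :: s) ys)).
  have [m _ Cx] := hs x (mem_head x s).
  exists (maxn m n) => y; rewrite inE => /orP [/eqP ->|ys].
    by apply: Cmono Cx; exact: leq_maxl.
  by apply: Cmono (nP _ ys); exact: leq_maxr.
have [_] := CS n; apply => x Cx.
have : U x by exists n.+1.
by rewrite UE; apply; split => //; exact/sF.
Qed.

Hypotheses (noeth : noetherian A) (dim1 : krull_dim_eq A 1).

Lemma proper_sub_maximal (I : set A) : proper_ideal_set I ->
  exists p : maxideal A, I `<=` p.
Proof.
move=> pI.
have [||J [pJ IJ] Jm] := @noetherian_max [set J : set A | proper_ideal_set J /\ I `<=` J] noeth.
- by exists I; split.
- by move=> J [/proper_idealP []].
suff mJ : maximal_ideal J by exists (MaxIdeal mJ).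
by split=> // L pL JL; apply: Jm => //; split=> //; exact: subset_trans JL.
Qed.

Lemma mi_prime_ideal (p : maxideal A) : prime_ideal p.
Proof. by split; [exact: (mi_maximal p).1|exact: mi_prime]. Qed.

(** Otherwise the zero ideal, [q] and a maximal ideal above it would be a chain
    of length two. *)
Lemma prime_maximal (q : set A) a : prime_ideal q -> q a -> a != 0 -> maximal_ideal q.
Proof.
move=> primeq qa a0; split=> [|J pJ qJ]; first exact: primeq.1.
apply: contrapT => JNq; have [m Jm] := proper_sub_maximal pJ.
have prime0 : prime_ideal [set 0 : A].
  split.
    by apply/proper_idealP; split; [exact: submodule0|by move=> /= /eqP; rewrite oner_eq0].
  by move=> u v /set_mem /eqP; rewrite mulf_eq0 => /orP [] /eqP ->;
    apply/orP; [left|right]; apply/mem_set.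
have q0 : q 0 by have /proper_idealP [/sub0] := primeq.1.
have [_ /(_ 2%N)] := dim1; apply/not_implyP; split=> //.
pose C n : set A := nth (m : set A) [:: [set 0]; q] n.
exists C; rewrite /C; split=> [[|[|[|]]]|[|[|]]] //= _.
- exact: mi_prime_ideal.
- split=> [x -> //|].
  by move=> /(_ _ qa) /eqP; rewrite (negPf a0).
- split; first exact: subset_trans Jm.
  by move=> mq; apply: JNq; apply/seteqP; split=> //; exact: subset_trans mq.
Qed.

(** A field has no prime chain of length one. *)
Lemma mi_nonzero (p : maxideal A) : exists2 a, (p : set A) a & a != 0.
Proof.
apply: contrapT => np; have [[C [primeC CS]] _] := dim1.
have p0 : (p : set A) `<=` [set 0].
  by move=> a pa; apply: contrapT => /eqP a0; apply: np; exists a.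
have pC1 : (p : set A) `<=` C 1%N.
  move=> a /p0 ->; have /proper_idealP [sC _] := (primeC 1%N isT).1; exact: (sub0 sC).
have C1p := (mi_maximal p).2 _ (primeC 1%N isT).1 pC1.
have [_] := CS 0%N isT; apply; rewrite C1p => a /p0 ->.
by have /proper_idealP [sC _] := (primeC 0%N isT).1; exact: (sub0 sC).
Qed.

(** A maximal one among the annihilators of the nonzero elements of [A / I] is
    prime; it contains [a], so it is maximal. *)
Lemma associated_maximal (I : set A^o) a : submodule I -> a != 0 -> I a -> ~ I 1 ->
  exists x, [/\ ~ I x & maximal_ideal [set b : A | I (b *: x)]].
Proof.
move=> sI a0 Ia I1; pose q (x : A^o) : set A^o := [set b : A | I (b *: x)].
have sq x : submodule (q x).
  apply/submoduleP; split; first by rewrite /q /= scale0r; exact: sub0.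
  by move=> b c d qc qd; rewrite /q /= scalerDl -scalerA; exact: subZD.
have [||J [x Ix JE] Jm] :=
    @noetherian_max [set J | exists2 x, ~ I x & J = q x] noeth.
- by exists (q 1), 1.
- by move=> J [x _ ->].
rewrite {J}JE in Jm.
have pq : proper_ideal_set (q x : set A).
  by apply/proper_idealP; split=> //; rewrite /q /= scale1r.
exists x; split=> //; apply: (@prime_maximal _ a) => //; last first.
  by rewrite /= /GRing.scale /= mulrC; exact: (@subZ _ A^o).
split=> // u v /set_mem quv; apply/orP.
have [qv|qv] := pselect (q x v); first by right; exact: mem_set.
left; apply/mem_set; rewrite -[[set b | _]](Jm (q (v *: x))) => //=.
- by rewrite /q /= scalerA.
- by exists (v *: x).
- by move=> b qb; rewrite /q /= scalerA mulrC -scalerA; exact: subZ.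
Qed.

(** A largest ideal without a series up to [A] would have a simple extension
    by an element with maximal annihilator, from which a series does start. *)
Lemma exists_series (V : nmodType) (h : set A -> V) (a : A) (N : set A^o) :
  a != 0 -> submodule N -> N a -> exists n v, series h N n setT v.
Proof.
move=> a0 sN Na; apply: contrapT => nN.
have [||J [sJ Ja nJ] Jm] := @noetherian_max
    [set I : set A^o | [/\ submodule I, I a & ~ exists n v, series h I n setT v]] noeth.
- by exists N.
- by move=> J [].
have J1 : ~ J 1.
  move=> J1; apply: nJ; exists 0%N, 0; have -> : setT = J; last exact: series_refl.
  by apply/seteqP; split=> // b _; rewrite -[b]mulr1; exact: subZ.
have [x [Jx mx]] := associated_maximal sJ a0 Ja J1.
pose p := MaxIdeal mx.
have cJ := cover_span sJ Jx (@mi_inverse _ p) (fun b pb => pb).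
have [//|/contrapT [n [v sn]]] := pselect (~ exists n v,
    series h (addm J (range (fun a : A => a *: x))) n setT v).
  move=> nJx; apply: Jx; rewrite -(Jm (addm J (range (fun a : A => a *: x)))).
  - by apply: addm_subr => //; exists 1 => //; rewrite scale1r.
  - split=> //; first by case: cJ.
    by apply: addm_subl; last exact: Ja; exact: submodule_cyclic.
  - exact: (addm_subl (submodule_cyclic x)).
by apply: nJ; exists (1 + n)%N, (h (ann J (addm J (range (fun a : A => a *: x)))) + v);
  exact: series_cat (series1 h cJ) sn.
Qed.

End NoetherianDomain.

(** * The divisor of a module of finite length *)

Section Cycles.
Variable A : idomainType.

Definition ideal_div (I : set A) : Div A :=
  if pselect (maximal_ideal I) is left m then << MaxIdeal m >> else 0.

Local Notation cycle := (series ideal_div).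

Lemma ideal_div_mi (p : maxideal A) : ideal_div p = << p >>.
Proof.
rewrite /ideal_div; case: pselect => [m|]; last by case; exact: mi_maximal.
by congr << _ >>; exact: mi_inj.
Qed.

Lemma ideal_div_covers (M : lmodType A) (N N' : set M) (p : maxideal A) :
  covers N N' -> (p : set A) `<=` ann N N' -> ideal_div (ann N N') = << p >>.
Proof. by move=> cN /(ann_eq cN) ->; exact: ideal_div_mi. Qed.

Lemma cycle_ge0 (M : lmodType A) (N N' : set M) n D p :
  cycle N n N' D -> (0 <= coeff p D)%R.
Proof.
elim=> [_|{}n L L' {}D _ IH cL]; first by rewrite coeff0.
rewrite coeffD Num.Theory.addr_ge0 // -[ann _ _]/(mi_set (cover_mi cL)) ideal_div_mi.
by rewrite coeffU mul1r Num.Theory.ler0n.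
Qed.

(** An element outside [p] acts invertibly on [A / p], so [A / p] is not a
    factor of a module killed by it. *)
Lemma cycle_killed (M : lmodType A) (N N' : set M) n D (p : maxideal A) s :
  cycle N n N' D -> ~ (p : set A) s -> ann N N' s -> coeff p D = 0.
Proof.
elim=> [_|{}n L L' {}D sL IH cL] ps ns; first by rewrite coeff0.
have [_ _ NL] := seriesP sL; have [_ _ [LL' _] _] := cL.
rewrite coeffD IH // => [|x Lx]; last by apply: ns; exact: LL'.
rewrite add0r -[ann _ _]/(mi_set (cover_mi cL)) ideal_div_mi coeffU mul1r.
suff /eqP /negbTE -> : cover_mi cL <> p by [].
by move=> E; apply: ps; rewrite -E => x /ns; exact: NL.
Qed.

Lemma cycle_isotypic (M : lmodType A) (N N' : set M) n D (p : maxideal A) :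
  cycle N n N' D -> (p : set A) `<=` ann N N' -> D = << p >> *+ n.
Proof.
elim=> [//|{}n L L' {}D sL IH cL] pN.
have [_ _ NL] := seriesP sL; have [_ _ [LL' _] _] := cL.
rewrite IH => [|a /pN aN x /LL' /aN //].
by rewrite (ideal_div_covers (p := p)) -?mulrSr // => a /pN aN x /aN; exact: NL.
Qed.

Definition principal_ideal (a : A) : set A^o := range (fun b : A => b *: (a : A^o)).

Lemma principal_submodule a : submodule (principal_ideal a).
Proof. exact: submodule_cyclic. Qed.

Lemma principal_ideal_id a : principal_ideal a a.
Proof. by exists 1 => //; rewrite scale1r. Qed.

(** For a one-dimensional noetherian domain this is [exists_series]; for its
    normalization it follows from lengths over the domain. *)
Definition finite_colength : Prop := forall (N : set A^o) (a : A),
  submodule N -> a != 0 -> N a -> exists n D, cycle N n setT D.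

Definition divisor (a : A) : Div A :=
  xget 0 [set D | exists n, cycle (principal_ideal a) n setT D].

Hypothesis fin : finite_colength.

Lemma divisor_cycle a : a != 0 -> exists n, cycle (principal_ideal a) n setT (divisor a).
Proof.
move=> a0.
have [n [D sD]] := fin (principal_submodule a) a0 (principal_ideal_id a).
rewrite /divisor; case: xgetP => [_ _ //|/(_ D) []]; by exists n.
Qed.

Lemma divisorE a n D : cycle (principal_ideal a) n setT D -> divisor a = D.
Proof.
move=> sD; apply: xget_unique; first by exists n.
by move=> D' [m sD']; have [] := Jordan_Hoelder sD' sD.
Qed.

Definition mulr_by (a : A) (x : A^o) : A^o := x * a.

Lemma mulr_by_linear (a : A) : linear (mulr_by a).
Proof. by move=> c x y; rewrite /mulr_by mulrDl scalerAl. Qed.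

HB.instance Definition _ (a : A) :=
  GRing.isLinear.Build A A^o A^o _ (mulr_by a) (mulr_by_linear a).

Lemma mulr_by_inj a : a != 0 -> injective (mulr_by a).
Proof. by move=> a0 x y /= /(mulIf a0). Qed.

(** The factors of [A / abA] are those of [A / bA] and of [bA / abA], and
    multiplication by [b] identifies the latter with [A / aA]. *)
Lemma divisorM a b : a != 0 -> b != 0 -> divisor (a * b) = divisor a + divisor b.
Proof.
move=> a0 b0; have [n sa] := divisor_cycle a0; have [m sb] := divisor_cycle b0.
apply: (@divisorE _ (n + m)%N); apply: series_cat _ sb.
have := series_image (mulr_by_inj b0) sa.
have -> : mulr_by b @` principal_ideal a = principal_ideal (a * b).
  apply/seteqP; split=> [_ [_ [c _ <-] <-]|_ [c _ <-]]; rewrite /=.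
    by exists c => //; rewrite scalerAl.
  by exists (c *: (a : A^o)); [exists c|rewrite /= scalerAl].
exact.
Qed.

End Cycles.

(** * Localization and the divisor of a function *)

Section Localize.
Variables (A : idomainType) (p : maxideal A).
Local Notation L := (loc p).
Local Notation tl := (@to_loc A p).

Lemma mi_notin (s : A) : ~ (p : set A) s <-> s \notin mi_pred p.
Proof. by split=> [ps|/negP ps ?]; [apply/negP => /set_mem|apply/ps/mem_set]. Qed.

Lemma to_loc_zmod : zmod_morphism tl.
Proof. by move=> a b; apply: val_inj; rewrite /= tofracB. Qed.

Lemma to_loc_monoid : monoid_morphism tl.
Proof. by split=> [|a b]; apply: val_inj; rewrite /= ?tofrac1 ?tofracM. Qed.

HB.instance Definition _ := GRing.isZmodMorphism.Build A L tl to_loc_zmod.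
HB.instance Definition _ := GRing.isMonoidMorphism.Build A L tl to_loc_monoid.

Lemma to_loc_inj : injective tl.
Proof. by move=> a b [/eqP]; rewrite tofrac_eq => /eqP. Qed.

Lemma loc_fraction (c : L) : exists s a, ~ (p : set A) s /\ tl s * c = tl a.
Proof.
have /asboolP [a [s [ps cE]]] := valP c.
exists s, a; split; first exact/mi_notin.
by apply: val_inj; rewrite /= cE mulrC divfK //; exact: mi_compl_neq0 ps.
Qed.

Lemma to_loc_unit s : ~ (p : set A) s -> exists c : L, c * tl s = 1.
Proof.
move=> /mi_notin ps.
have cP : (tofrac s)^-1 \in loc_pred p.
  by apply/asboolP; exists 1, s; rewrite tofrac1 div1r.
by exists (Loc cP); apply: val_inj; rewrite /= mulVf //; exact: mi_compl_neq0 ps.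
Qed.

Lemma mi_compl_mul s t : ~ (p : set A) s -> ~ (p : set A) t -> ~ (p : set A) (s * t).
Proof. by move=> ps pt /mi_mul []. Qed.

Definition localized (N : set A^o) : set L^o :=
  [set x | exists s u, [/\ ~ (p : set A) s, N u & tl s * x = tl u]].

Lemma localized_submodule N : submodule N -> submodule (localized N).
Proof.
move=> sN; apply/submoduleP; split.
  exists 1, 0; split; [exact: mi_not1|exact: sub0|].
  by rewrite mulr0 rmorph0.
move=> c x y [s [u [ps Nu su]]] [t [v [pt Nv tv]]].
have [r [a [pr ra]]] := loc_fraction c.
exists (r * (s * t)), (a * t * u + r * s * v); split.
- by apply: mi_compl_mul => //; exact: mi_compl_mul.
- by apply: (@subD _ A^o) => //; exact: (@subZ _ A^o).
rewrite mulrDr rmorphD !rmorphM /= -ra -su -tv.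
congr (_ + _).
  rewrite /GRing.scale /= -!mulrA; congr (_ * _).
  by rewrite (mulrCA (tl s)) (mulrCA c) (mulrCA (tl s)).
by rewrite -!mulrA.
Qed.

Lemma localized_sub (N N' : set A^o) : N `<=` N' -> localized N `<=` localized N'.
Proof. by move=> NN' x [s [u [ps /NN' N'u e]]]; exists s, u. Qed.

Lemma localized_to_loc (N : set A^o) u : submodule N ->
  localized N (tl u) <-> exists2 s, ~ (p : set A) s & N (s * u).
Proof.
move=> sN; split=> [[s [v [ps Nv]]]|[s ps Nsu]].
  by rewrite -rmorphM => /to_loc_inj e; exists s => //; rewrite e.
by exists s, (s * u); rewrite rmorphM.
Qed.

(** An element of the localization of [N' / N] is a unit times an element of
    [A] acting on a generator [x], and elements outside [p] act invertibly. *)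
Lemma localized_covers (N N' : set A^o) : covers N N' -> ann N N' = p ->
  covers (localized N) (localized N').
Proof.
move=> cN annp; have [sN sN' [NN' _] _] := cN; have [x N'x Nx] := cover_new cN.
split; [exact: localized_submodule|exact: localized_submodule| |].
  split=> [|h]; first exact: localized_sub.
  have /h : localized N' (tl x).
    by apply/localized_to_loc => //; exists 1; [exact: mi_not1|rewrite mul1r].
  move/(localized_to_loc _ sN) => [s ps Nsx]; have [b pb] := mi_inverse ps.
  apply: Nx; rewrite -[x](mul1r x) -[1](subrK (b * s)) mulrDl.
  apply: subD => //; last by rewrite -mulrA; exact: (@subZ _ A^o).
  by move: pb; rewrite -annp; exact.
move=> X sX NX XN'; have [XN|] := pselect (X `<=` localized N).
  by left; apply/seteqP.
move=> /existsNP [y /not_implyP [Xy Ny]]; right; apply/seteqP; split=> //.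
have [s [u [ps N'u su]]] := XN' _ Xy.
have Nsu : X (tl u) by rewrite -su; exact: (@subZ _ L^o).
move: N'u; rewrite -(cover_cyclic cN N'x Nx) => -[n Nn [_ [b _ <-] uE]].
have pb : ~ (p : set A) b.
  rewrite -annp => /(_ _ N'x) Nbx; apply: Ny; exists s, u; split=> //.
  by rewrite -uE; exact: subD.
have [c cb] := to_loc_unit pb.
have Xx : X (tl x).
  have -> : tl x = c * (tl u - tl n).
    by rewrite -uE rmorphD addrAC subrr add0r rmorphM mulrA cb mul1r.
  apply: (@subZ _ L^o) => //; apply: (@subB _ L^o) => //.
  by apply/NX/localized_to_loc => //; exists 1; [exact: mi_not1|rewrite mul1r].
move=> z [t [v [pt N'v tv]]]; have [d dt] := to_loc_unit pt.
have -> : z = d * tl v by rewrite -tv mulrA dt mul1r.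
apply: (@subZ _ L^o) => //.
move: N'v => -[m Nm [_ [e _ <-] <-]].
rewrite rmorphD rmorphM; apply: (@subD _ L^o) => //; last exact: (@subZ _ L^o).
by apply/NX/localized_to_loc => //; exists 1; [exact: mi_not1|rewrite mul1r].
Qed.

Lemma localized_trivial (N N' : set A^o) s : ~ (p : set A) s -> ann N N' s ->
  N `<=` N' -> localized N = localized N'.
Proof.
move=> ps ns NN'; apply/seteqP; split; first exact: localized_sub.
move=> x [t [u [pt N'u tu]]]; exists (s * t), (s * u); split.
- exact: mi_compl_mul.
- exact: ns.
by rewrite !rmorphM -mulrA tu.
Qed.

(** Localizing at [p] keeps the composition factors isomorphic to [A / p] and
    kills the others. *)
Lemma localized_series (N N' : set A^o) n D : series (@ideal_div A) N n N' D ->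
  exists2 m, coeff p D = m%:Z &
    series (fun=> 0%N) (localized N) m (localized N') 0%N.
Proof.
elim=> [sN|{}n K K' {}D _ [m mD sm] cK].
  by exists 0%N; [rewrite coeff0|exact/series_refl/localized_submodule].
rewrite coeffD mD -[ann _ _]/(mi_set (cover_mi cK)) ideal_div_mi coeffU mul1r.
have [E|E] := eqVneq (cover_mi cK) p.
  exists m.+1; first by rewrite -addn1 PoszD.
  by apply: series_step sm (localized_covers cK _); rewrite -E.
exists m; first by rewrite addr0.
have [s ns ps] := mi_neq (elimN eqP E).
by have [_ _ [KK' _] _] := cK; rewrite -(localized_trivial ps ns KK').
Qed.

Lemma localizedT : localized setT = setT.
Proof.
apply/seteqP; split=> // c _; have [s [a [ps sa]]] := loc_fraction c.
by exists s, a.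
Qed.

Lemma localized_principal a :
  localized (principal_ideal a) = lspan [set tl a : L^o].
Proof.
apply/seteqP; split.
  move=> x [s [_ [ps [b _ <-] sx]]] N [sN Na].
  have [c cs] := to_loc_unit ps.
  have -> : x = c * tl b * tl a.
    by rewrite -mulrA -rmorphM -[LHS]mul1r -cs -mulrA sx.
  by apply: (@subZ _ L^o) => //; exact: Na.
move=> x; apply; split; first exact/localized_submodule/principal_submodule.
move=> _ ->; apply/localized_to_loc; first exact: principal_submodule.
by exists 1; [exact: mi_not1|rewrite mul1r; exact: principal_ideal_id].
Qed.

End Localize.

Section QuotientModule.
Variables (R : nzRingType) (M : lmodType R) (S : set M).

Definition quotm_pi (x : M) : quotm S := \pi_(quotm S)%qT x.

Lemma quotm_pi_linear : linear quotm_pi.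
Proof.
move=> a x y; rewrite /quotm_pi pi_quotmD; congr (_ + _).
exact/esym/pi_qscale.
Qed.

HB.instance Definition _ := GRing.isLinear.Build R M (quotm S) _ quotm_pi quotm_pi_linear.

Lemma quotm_pi_eq0 x : quotm_pi x = 0 -> lspan S x.
Proof.
move=> /eqP; rewrite -[0](raddf0 quotm_pi) /quotm_pi -Quotient.idealrBE subr0.
exact: set_mem.
Qed.

Lemma quotm_pi_surj : range quotm_pi = setT.
Proof. by apply/seteqP; split=> // x _; exists (repr x) => //; exact: reprK. Qed.

Lemma series_quotm (V : nmodType) (h : set R -> V) n v :
  series h (lspan S) n setT v -> series h [set 0] n [set: quotm S] v.
Proof.
move=> sS; have := series_map (f := quotm_pi) (submodule0 _) sS.
have -> : addm [set 0] (quotm_pi @` lspan S) = [set 0].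
  apply/seteqP; split=> [_ [_ -> [_ [x Sx <-] <-]]|_ ->] /=.
    rewrite add0r; apply/eqP; rewrite -[0](raddf0 quotm_pi) /quotm_pi.
    by rewrite -Quotient.idealrBE subr0; exact: mem_set.
  exists 0 => //; exists 0; last by rewrite addr0.
  by exists 0; [have [/sub0] := seriesP sS|rewrite raddf0].
rewrite quotm_pi_surj.
have -> : addm [set 0] [set: quotm S] = setT.
  by apply/seteqP; split=> // x _; exists 0 => //; exists x => //; rewrite add0r.
by apply=> x [_ /quotm_pi_eq0].
Qed.

End QuotientModule.

Section DivisorOfFunction.
Variable A : idomainType.
Hypothesis fin : finite_colength A.

Lemma len_atE (p : maxideal A) a : a != 0 -> (len_at p a)%:Z = coeff p (divisor a).
Proof.
move=> a0; have [n sa] := divisor_cycle fin a0.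
have [m -> sm] := localized_series p sa.
rewrite /len_at; congr Posz; apply: (len_series (h := fun=> 0%N) (v := 0%N)).
by apply: series_quotm; rewrite -localized_principal -(localizedT p).
Qed.

Lemma freeg_fsbigE (D : Div A) :
  \sum_(q \in [set: maxideal A]) << coeff q D *g q >> = D.
Proof.
rewrite (fsbigE (dom D)) //.
- rewrite -[RHS]freeg_sumE; apply: eq_bigl => q; exact: in_setT.
- exact: uniq_dom.
by move=> q _ /coeff_outdom ->; rewrite freegU0.
Qed.

Lemma fraction_repr (x : {fraction A}) :
  tofrac \n_(repr x) / tofrac \d_(repr x) = x.
Proof.
have d0 := denom_ratioP (repr x).
apply: (canLR (mulfK _)); first by rewrite tofrac_eq0.
rewrite -[x in RHS]reprK; unlock FracField.tofrac; rewrite -[RHS]FracField.pi_mul.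
apply/eqmodP; rewrite /= FracField.equivfE /FracField.mulf.
rewrite !numden_Ratio ?oner_neq0 ?mulr1 ?d0 //.
by rewrite mul1r reprK.
Qed.

Lemma div_fraction (a b : A) : a != 0 -> b != 0 ->
  div (tofrac a / tofrac b) = divisor a - divisor b.
Proof.
move=> a0 b0; set x := _ / _.
have d0 : \d_(repr x) != 0 by exact: denom_ratioP.
have xE : tofrac \n_(repr x) / tofrac \d_(repr x) = x by exact: fraction_repr.
have n0 : \n_(repr x) != 0.
  apply/eqP => n0; have := xE; rewrite n0 tofrac0 mul0r => /esym/eqP.
  by rewrite mulf_eq0 invr_eq0 !tofrac_eq0 (negPf a0) (negPf b0).
have E : divisor \n_(repr x) + divisor b = divisor a + divisor \d_(repr x).
  rewrite -!divisorM //; congr divisor; apply/eqP; rewrite -tofrac_eq !tofracM.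
  by rewrite -eqr_div ?tofrac_eq0 // xE.
have -> : divisor a - divisor b = divisor \n_(repr x) - divisor \d_(repr x).
  by apply/eqP; rewrite subr_eq addrAC eq_sym subr_eq E.
rewrite -[RHS]freeg_fsbigE; apply: eq_fsbigr => q _.
by rewrite /ord !len_atE // coeffB.
Qed.

End DivisorOfFunction.

(** * Push-forward and residue degrees *)

Section PushForward.
Variable O : idomainType.
Local Notation Ot := (normalization O).

Definition push_lift : Div Ot -> Div O :=
  fglift (fun P => << (res_degree P)%:Z *g contraction P >> : Div O).

HB.instance Definition _ := GRing.isZmodMorphism.Build (Div Ot) (Div O) push_lift
  (lift_is_additive _).

Lemma push_liftU k (P : maxideal Ot) :
  push_lift << k *g P >> = << k * (res_degree P)%:Z *g contraction P >>.
Proof.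
rewrite /push_lift liftU; apply/eqP/freeg_eqP => q.
by rewrite coeffZ !coeffU mulrA.
Qed.

Lemma push_forward_fglift D : push_forward D = push_lift D.
Proof.
rewrite -[in RHS](freeg_sumE D) raddf_sum; apply: eq_bigr => P _.
exact/esym/push_liftU.
Qed.

Lemma push_forward_zmod : zmod_morphism (@push_forward O).
Proof. by move=> D E; rewrite !push_forward_fglift raddfB. Qed.

HB.instance Definition _ :=
  GRing.isZmodMorphism.Build (Div Ot) (Div O) (@push_forward O) push_forward_zmod.

Lemma push_forwardU k (P : maxideal Ot) :
  push_forward << k *g P >> = << k * (res_degree P)%:Z *g contraction P >>.
Proof. by rewrite push_forward_fglift push_liftU. Qed.

End PushForward.

Lemma widen_ordE n (i : 'I_n) : widen_ord (leqnSn n) i = fintype.lift ord_max i.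
Proof. by apply: val_inj; exact/esym/lift_max. Qed.

Section ResidueBasis.
Variables (O : idomainType) (P : maxideal (normalization O)).
Local Notation Ot := (normalization O).
Local Notation p := (contraction P).
Local Notation piO := (\pi_(residue p)%qT).
Local Notation piP := (\pi_(residue P)%qT).

Lemma pi_eq0 (A : comNzRingType) (q : maxideal A) (a : A) :
  \pi_(residue q)%qT a = 0 <-> (q : set A) a.
Proof.
split=> [/eqP|qa]; last apply/eqP; rewrite -[X in _ == X](raddf0 \pi_(residue q)%qT).
  by rewrite -Quotient.idealrBE subr0 => /set_mem.
by rewrite -Quotient.idealrBE subr0; exact: mem_set.
Qed.

Lemma res_map_zmod : zmod_morphism (@res_map O P).
Proof.
move=> x y; rewrite -[x]reprK -[y]reprK -[X in res_map X]rmorphB !res_mapE.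
by rewrite !rmorphB.
Qed.

Lemma res_map_monoid : monoid_morphism (@res_map O P).
Proof.
split=> [|x y]; first by rewrite -[1](rmorph1 piO) res_mapE !rmorph1.
rewrite -[x]reprK -[y]reprK -[X in res_map X]rmorphM !res_mapE.
by rewrite !rmorphM.
Qed.

HB.instance Definition _ :=
  GRing.isZmodMorphism.Build _ _ (@res_map O P) res_map_zmod.
HB.instance Definition _ :=
  GRing.isMonoidMorphism.Build _ _ (@res_map O P) res_map_monoid.

Lemma pi_norm_scale (a : O) (x : Ot) : piP (a *: x) = res_map (piO a) * piP x.
Proof. by rewrite res_mapE -rmorphM. Qed.

Definition res_span n (b : 'I_n -> residue P) : set Ot :=
  [set y | exists c : 'I_n -> residue p, piP y = \sum_i res_map (c i) * b i].

Definition res_free n (b : 'I_n -> residue P) : Prop :=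
  forall c : 'I_n -> residue p, \sum_i res_map (c i) * b i = 0 -> forall i, c i = 0.

Lemma res_span_submodule n (b : 'I_n -> residue P) : submodule (res_span b).
Proof.
apply/submoduleP; split.
  exists (fun=> 0); rewrite raddf0 big1 // => i _.
  by rewrite raddf0 mul0r.
move=> a x y [c cE] [d dE]; exists (fun i => piO a * c i + d i).
rewrite rmorphD /= pi_norm_scale cE dE mulr_sumr -big_split; apply: eq_bigr => i _ /=.
by rewrite rmorphD rmorphM mulrDl mulrA.
Qed.

Lemma mi_res_submodule : submodule (P : set Ot).
Proof.
apply/submoduleP; split; first exact: (sub0 (mi_submodule P)).
move=> a x y Px Py; exact: (@subZD _ Ot^o _ (to_norm a) _ _ (mi_submodule P)).
Qed.

Lemma res_span0 (b : 'I_0 -> residue P) : res_span b = P.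
Proof.
apply/seteqP; split=> y; first by move=> [c]; rewrite big_ord0 => /pi_eq0.
by move=> /pi_eq0 Py; exists (fun=> 0); rewrite big_ord0.
Qed.

Lemma mi_sub_res_span n (b : 'I_n -> residue P) : (P : set Ot) `<=` res_span b.
Proof.
move=> y /pi_eq0 Py; exists (fun=> 0); rewrite Py big1 // => i _.
by rewrite raddf0 mul0r.
Qed.

Lemma res_spanS n (b : 'I_n.+1 -> residue P) x : piP x = b ord_max ->
  res_span b = addm (res_span (b \o widen_ord (leqnSn n))) (range (fun a : O => a *: x)).
Proof.
move=> xE; apply/seteqP; split=> y.
  move=> [c]; rewrite big_ord_recr /= -xE => yE.
  pose a := repr (c ord_max).
  exists (y - a *: x).
    exists (c \o widen_ord (leqnSn n)).
    by rewrite rmorphB /= pi_norm_scale reprK yE addrK.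
  by exists (a *: x); [exists a|rewrite subrK].
move=> [z [c zE] [_ [a _ <-] <-]].
exists (fun i => if unlift ord_max i is Some j then c j else piO a).
rewrite rmorphD /= pi_norm_scale zE big_ord_recr /= unlift_none xE; congr (_ + _).
apply: eq_bigr => i _; congr (res_map _ * _).
by rewrite widen_ordE liftK.
Qed.

Lemma res_freeW n (b : 'I_n.+1 -> residue P) :
  res_free b -> res_free (b \o widen_ord (leqnSn n)).
Proof.
move=> fb c c0 i; pose c' j := if unlift ord_max j is Some k then c k else 0.
have <- : c' (fintype.lift ord_max i) = c i by rewrite /c' liftK.
apply: fb; rewrite big_ord_recr /= {2}/c' unlift_none raddf0 mul0r addr0 -[RHS]c0.
by apply: eq_bigr => j _; rewrite /= /c' widen_ordE liftK.
Qed.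

Lemma contraction_mul a x : (p : set O) a -> (P : set Ot) (a *: x).
Proof.
move=> pa; suff : (P : set Ot) (x * to_norm a) by rewrite mulrC.
exact: (@subZ _ Ot^o _ _ _ (mi_submodule P)).
Qed.

Lemma res_span_covers n (b : 'I_n -> residue P) x : ~ res_span b x ->
  covers (res_span b) (addm (res_span b) (range (fun a : O => a *: x))).
Proof.
move=> nx; apply: (@cover_span _ _ _ _ (p : set O)) => //.
- exact: res_span_submodule.
- exact: mi_inverse.
by move=> a pa; apply: mi_sub_res_span; exact: contraction_mul.
Qed.

Section WithWeight.
Variables (V : nmodType) (h : set O -> V).

(** The spans of the initial segments of a free family form a composition
    series above [P]; this makes the number of elements of a basis an invariant. *)
Lemma series_of_res_free n (b : 'I_n -> residue P) : res_free b ->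
  exists v, series h (P : set Ot) n (res_span b) v.
Proof.
elim: n b => [|n IH] b fb.
  by exists 0; rewrite res_span0; apply: series_refl; exact: mi_res_submodule.
have [v sv] := IH _ (res_freeW fb).
pose x := repr (b ord_max); have xE : piP x = b ord_max by rewrite reprK.
rewrite (res_spanS xE); eexists; apply: (series_step sv); apply: res_span_covers.
move=> [c cE]; have := fb (fun i => if unlift ord_max i is Some j then c j else -1).
move=> /(_ _ ord_max); rewrite unlift_none => c0.
have /eqP : -1 = 0 :> residue p.
  apply: c0; rewrite big_ord_recr /= unlift_none rmorphN1 mulN1r -xE cE.
  apply/eqP; rewrite subr_eq0; apply/eqP; apply: eq_bigr => j _ /=.
  by rewrite widen_ordE liftK.
by rewrite oppr_eq0 oner_eq0.
Qed.

(** Conversely, representatives of generators of the factors are a basis. *)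
Lemma res_free_of_series n N v : series h (P : set Ot) n N v ->
  exists b : 'I_n -> residue P, res_free b /\ res_span b = N.
Proof.
elim=> [_|{}n L L' {}v _ [b [fb bL]] cL].
  exists (fun=> 0); split; last by rewrite res_span0.
  by move=> c _ [].
have [x L'x Lx] := cover_new cL.
pose b' i := if unlift ord_max i is Some j then b j else piP x.
have b'E : b' \o widen_ord (leqnSn n) = b.
  by apply: funext => i; rewrite /b' /= widen_ordE liftK.
have xE : piP x = b' ord_max by rewrite /b' unlift_none.
exists b'; split; last by rewrite (res_spanS xE) b'E bL (cover_cyclic cL).
move=> c c0; have cmax : c ord_max = 0.
  rewrite -[c ord_max]reprK; apply/pi_eq0; apply: contrapT.
  set a := repr _ => /mi_inverse [a' a'a]; apply: Lx; rewrite -bL.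
  exists (fun i => piO (- a') * c (widen_ord (leqnSn n) i)).
  rewrite -[x](subrK (a' *: (a *: x))) rmorphD /=.
  have -> : piP (x - a' *: (a *: x)) = 0.
    by apply/pi_eq0; rewrite scalerA -{1}[x]scale1r -scalerBl; exact: contraction_mul.
  rewrite add0r scalerA.
  move: c0; rewrite big_ord_recr /= -xE -[c ord_max]reprK -pi_norm_scale -/a.
  move/eqP; rewrite addrC addr_eq0 => /eqP ax.
  rewrite -scalerA pi_norm_scale ax mulrN -mulNr -!rmorphN mulr_sumr.
  apply: eq_bigr => i _; rewrite rmorphM -mulrA; congr (_ * (_ * _)).
  by rewrite widen_ordE /b' liftK.
move=> i; case: (unliftP ord_max i) => [j ->|-> //].
have := fb (c \o widen_ord (leqnSn n)) _ j; rewrite /= widen_ordE; apply.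
move: c0; rewrite big_ord_recr /= cmax raddf0 mul0r addr0 => c0.
rewrite -[RHS]c0; apply: eq_bigr => k _ /=.
by rewrite widen_ordE /b' liftK.
Qed.

Lemma res_degreeE n v : series h (P : set Ot) n setT v -> res_degree P = n.
Proof.
move=> sn; have [b [fb bT]] := res_free_of_series sn.
apply: xget_unique.
  exists b => y; have : res_span b (repr y) by rewrite bT.
  move=> [c]; rewrite reprK => yE; exists [ffun i => c i]; split.
    by rewrite yE; apply: eq_bigr => i _; rewrite ffunE.
  move=> d; rewrite yE => /eqP; rewrite -subr_eq0 -sumrB => /eqP dE.
  apply/ffunP => i; apply/eqP; rewrite ffunE -subr_eq0; apply/eqP.
  apply: (fb (fun i => c i - d i)); rewrite -[RHS]dE; apply: eq_bigr => j _.
  by rewrite rmorphB mulrBl.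
move=> m [b' b'P].
have fb' : res_free b'.
  move=> c c0 i; have [d [_ dU]] := b'P 0.
  have /ffunP /(_ i) : [ffun i => c i] = [ffun=> 0].
    rewrite -(dU [ffun i => c i]) ?(dU [ffun=> 0]) //.
      by rewrite big1 // => j _; rewrite ffunE raddf0 mul0r.
    by rewrite -[LHS]c0; apply: eq_bigr => j _; rewrite ffunE.
  by rewrite !ffunE.
have b'T : res_span b' = setT.
  apply/seteqP; split=> // y _; have [c [yE _]] := b'P (piP y).
  by exists c.
have [w sw] := series_of_res_free fb'.
rewrite b'T in sw.
by have [-> _] := Jordan_Hoelder sw sn.
Qed.

End WithWeight.
End ResidueBasis.

(** * Push-forward of principal divisors *)

Section PushDivisor.
Variable O : idomainType.
Local Notation Ot := (normalization O).
Hypotheses (noethO : noetherian O) (dimO : krull_dim_eq O 1)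
  (fgO : finitely_generated [set: (Ot : lmodType O)]).

Lemma to_norm_inj : injective (@to_norm O).
Proof. by move=> a b [/eqP]; rewrite tofrac_eq => /eqP. Qed.

Lemma to_norm_eq0 (a : O) : (to_norm a == 0) = (a == 0).
Proof. by rewrite -(inj_eq to_norm_inj) rmorph0. Qed.

Lemma fraction_neq0 (x : Ot) a d : d != 0 -> x != 0 ->
  to_norm d * x = to_norm a -> a != 0.
Proof.
rewrite -(to_norm_eq0 d) => td0 x0 da; apply: contraNneq x0 => a0.
by move: da; rewrite a0 rmorph0 => /eqP; rewrite mulf_eq0 (negPf td0).
Qed.

Lemma norm_scaleE (a : O) (x : Ot) : a *: x = to_norm a * x.
Proof. by []. Qed.

Lemma norm_fraction (y : Ot) : exists d b, d != 0 /\ to_norm d * y = to_norm b.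
Proof.
exists \d_(repr (val y)), \n_(repr (val y)); split; first exact: denom_ratioP.
apply: val_inj; rewrite rmorphM /= -{2}(fraction_repr (norm_val y)).
by rewrite mulrC divfK // tofrac_eq0; exact: denom_ratioP.
Qed.

Lemma common_denominator :
  exists2 d : O, d != 0 & forall y : Ot, exists b, to_norm d * y = to_norm b.
Proof.
have [s sT] := fgO.
have [d d0 ds] : exists2 d : O, d != 0 &
    forall y, y \in s -> exists b, to_norm d * y = to_norm b.
  elim: s {sT} => [|y s [d d0 ds]]; first by exists 1; rewrite ?oner_neq0.
  have [e [b [e0 eb]]] := norm_fraction y.
  exists (d * e); first by rewrite mulf_neq0.
  move=> z; rewrite inE => /orP [/eqP ->|/ds [c dc]].
    by exists (d * b); rewrite !rmorphM -mulrA eb.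
  by exists (e * c); rewrite !rmorphM mulrAC dc mulrC.
exists d => // y; have : [set: Ot] y by [].
rewrite sT => /(_ [set z | exists b, to_norm d * z = to_norm b]).
apply; split=> [|z]; last exact: ds.
apply/submoduleP; split; first by exists 0; rewrite mulr0 rmorph0.
move=> a x z [b xb] [c zc]; exists (a * b + c).
rewrite rmorphD rmorphM mulrDr zc; congr (_ + _).
by rewrite norm_scaleE mulrCA xb.
Qed.

(** Multiplication by a common denominator embeds the normalization as an
    ideal of [O], whose subquotients have finite length. *)
Lemma norm_finite_length (V : nmodType) (h : set O -> V) (N : set Ot) (a : O) :
  submodule N -> a != 0 -> (forall y : Ot, N (a *: y)) ->
  exists n v, series h N n setT v.
Proof.
move=> sN a0 Na; have [d d0 /choice [g gP]] := common_denominator.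
pose toO (y : Ot) : O^o := g y.
have toO_linear : linear toO.
  move=> b x y; apply: to_norm_inj.
  rewrite /toO -gP rmorphD rmorphM /= -!gP mulrDr; congr (_ + _).
  by rewrite norm_scaleE mulrCA.
pose f : {linear Ot -> O^o} := HB.pack_for {linear Ot -> O^o} toO
  (GRing.isLinear.Build O Ot O^o _ toO toO_linear).
have fI : injective f.
  move=> x y /= xy; have dt0 : to_norm d != 0 by rewrite to_norm_eq0.
  by apply: (mulfI dt0); rewrite !gP; congr (to_norm _).
have sfN : submodule (f @` N) by exact: submodule_image.
have fNda : (f @` N) (a *: f 1) by exists (a *: (1 : Ot)) => //; rewrite linearZ.
have f1 : f 1 = d by apply: to_norm_inj; rewrite /= -gP mulr1.
have [|n [v sn]] := exists_series noethO dimO h _ sfN fNda.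
  by rewrite f1; exact: mulf_neq0.
have sT : submodule (f @` setT) by apply: submodule_image; exact: submoduleT.
have [|m [w [_ [_ [sm _]]]]] := series_interval sn sT _ (@subsetT _ _).
  exact: image_subset.
exact: series_preimage fI sN (submoduleT _) (@subsetT _ _) sm.
Qed.

Lemma norm_submodule (N : set Ot) : submodule (N : set Ot^o) -> submodule N.
Proof.
by move=> /submoduleP [N0 ND]; apply/submoduleP; split=> // a x y; exact: ND.
Qed.

Lemma norm_multiple (x : Ot) : x != 0 ->
  exists a y, a != 0 /\ to_norm a = x * y.
Proof.
move=> x0; have [d [a [d0 da]]] := norm_fraction x.
exists a, (to_norm d); split; last by rewrite mulrC.
exact: fraction_neq0 d0 x0 da.
Qed.

(** Submodules over the normalization are ranked by their length over [O]. *)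
Lemma norm_finite_colength : finite_colength Ot.
Proof.
move=> N x sN x0 Nx; have sNO := norm_submodule sN.
have [a [y [a0 ay]]] := norm_multiple x0.
have [z|n [v /series_rank [rho rhoP]]] := @norm_finite_length nat (fun=> 0%N) N a sNO a0.
  by rewrite norm_scaleE ay -mulrA mulrC; exact: (@subZ _ Ot^o).
apply: (@series_of_rank Ot _ (@ideal_div Ot) Ot^o N setT rho sN (submoduleT _)) => //.
by move=> L L' /norm_submodule sL /norm_submodule sL'; exact: rhoP.
Qed.

Lemma O_finite_colength : finite_colength O.
Proof. by move=> N a sN a0 Na; exact: (exists_series noethO dimO (@ideal_div O) a0 sN Na). Qed.

(** All factors over [O] of the residue field of [P] are killed by the
    contraction of [P], and their number is the dimension. *)
Lemma degree_cycle (P : maxideal Ot) :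
  series (@ideal_div O) (P : set Ot) (res_degree P) setT
    (<< contraction P >> *+ res_degree P).
Proof.
have [a pa a0] := mi_nonzero dimO (contraction P).
have [n [D sD]] := norm_finite_length (@ideal_div O) (mi_res_submodule P) a0
  (fun y => @contraction_mul O P a y pa).
rewrite (res_degreeE sD) -(cycle_isotypic sD (p := contraction P)) //.
by move=> b pb x _; exact: contraction_mul.
Qed.

Lemma res_degree_gt0 (P : maxideal Ot) : (0 < res_degree P)%N.
Proof.
rewrite lt0n; apply/eqP => /(series0 (degree_cycle P)) [PT _].
by apply: (@mi_not1 _ P); rewrite PT.
Qed.

Lemma mulr_norm_linear_subproof (x : Ot) : linear (fun z : Ot => z * x).
Proof. by move=> a y z; rewrite mulrDl !norm_scaleE mulrA. Qed.

Definition mulr_norm (x z : Ot) : Ot := z * x.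

HB.instance Definition _ (x : Ot) := GRing.isLinear.Build O Ot Ot _ (mulr_norm x)
  (mulr_norm_linear_subproof x).

(** A simple factor [N' / N] over the normalization is isomorphic to the
    residue field at its annihilator [P], whose length over [O] is the degree
    of [P]. *)
Lemma push_covers (N N' : set Ot^o) (P : maxideal Ot) : covers N N' ->
  ann N N' = P -> series (@ideal_div O) (N : set Ot) (res_degree P) N'
    (<< contraction P >> *+ res_degree P).
Proof.
move=> cN annP; have [sN sN' _ _] := cN; have [x N'x Nx] := cover_new cN.
have sNO := norm_submodule sN.
have := series_map (f := mulr_norm x) sNO (degree_cycle P).
have -> : addm (N : set Ot) (mulr_norm x @` P) = N.
  apply/seteqP; split; last exact: addm_subl (submodule_image _ (mi_res_submodule P)).
  apply: addm_lub => // _ [z Pz <-]; move: Pz; rewrite -annP; exact.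
have -> : addm (N : set Ot) (mulr_norm x @` setT) = N'.
  by rewrite -(cover_cyclic cN N'x Nx).
apply=> z [_ Nzx]; rewrite -annP; exact: (ann_cyclic cN N'x Nx).
Qed.

Lemma push_cycle (N N' : set Ot^o) n D : series (@ideal_div Ot) N n N' D ->
  exists m, series (@ideal_div O) (N : set Ot) m N' (push_forward D).
Proof.
elim=> [sN|{}n L L' {}D _ [m sm] cL].
  by exists 0%N; rewrite raddf0; exact/series_refl/norm_submodule.
exists (m + res_degree (cover_mi cL))%N; rewrite raddfD; apply: series_cat sm _.
rewrite -[ann _ _]/(mi_set (cover_mi cL)) ideal_div_mi /= push_forwardU mul1r.
by rewrite -natz -freegU_muln; exact: push_covers.
Qed.

Definition norm_embed : O^o -> Ot := @to_norm O.

Lemma norm_embed_linear : linear norm_embed.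
Proof. by move=> a x y; rewrite /norm_embed rmorphD rmorphM. Qed.

HB.instance Definition _ := GRing.isLinear.Build O O^o Ot _ norm_embed
  norm_embed_linear.

(** The cycle of the normalization modulo [a] and that of [O] modulo [a] differ
    by the cycles of [Ot / O] and [aOt / aO], which are isomorphic via
    multiplication by [a]. *)
Lemma push_divisor_to_norm (a : O) : a != 0 -> push_forward (divisor (to_norm a)) = divisor a.
Proof.
move=> a0; have ta0 : to_norm a != 0 by rewrite to_norm_eq0.
have [n /push_cycle [m sOt]] := divisor_cycle norm_finite_colength ta0.
have [k sO] := divisor_cycle O_finite_colength a0.
have sO' := series_image (f := norm_embed) to_norm_inj sO.
have [d d0 dO] := common_denominator.
have sT : submodule (norm_embed @` setT) by apply: submodule_image; exact: submoduleT.
have [y|l [w sw]] := norm_finite_length (@ideal_div O) sT d0.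
  by have [b dy] := dO y; exists b => //; rewrite -dy.
have saw := series_image (f := mulr_norm (to_norm a)) (mulIf ta0) sw.
have E1 : mulr_norm (to_norm a) @` (norm_embed @` setT) = norm_embed @` principal_ideal a.
  apply/seteqP; split=> [_ [_ [b _ <-] <-]|_ [_ [b _ <-] <-]].
    by exists (b * a) => /=; [exists b|rewrite /norm_embed /mulr_norm rmorphM].
  by exists (to_norm b); [exists b|rewrite /= /norm_embed /mulr_norm -rmorphM].
rewrite E1 in saw.
have [_] := Jordan_Hoelder (series_cat saw sOt) (series_cat sO' sw).
by rewrite addrC; exact: addIr.
Qed.

Lemma push_divisor (x : Ot) (a b : O) : x != 0 -> b != 0 -> to_norm b * x = to_norm a ->
  push_forward (divisor x) = divisor a - divisor b.
Proof.
move=> x0 b0 bx; have a0 : a != 0 by exact: fraction_neq0 b0 x0 bx.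
rewrite -(push_divisor_to_norm a0) -bx (divisorM norm_finite_colength) ?to_norm_eq0 //.
by rewrite raddfD -(push_divisor_to_norm b0) addrAC subrr add0r.
Qed.

Lemma push_principal (x : {fraction Ot}) : x != 0 ->
  exists2 y : {fraction O}, y != 0 & push_forward (div x) = div y.
Proof.
rewrite -(fraction_repr x); set n := \n_(repr x); set d := \d_(repr x).
rewrite mulf_eq0 invr_eq0 !tofrac_eq0 negb_or => /andP [n0 d0].
rewrite (div_fraction norm_finite_colength n0 d0).
have [b [a [b0 ab]]] := norm_fraction n; have [e [c [e0 ce]]] := norm_fraction d.
have a0 : a != 0 by exact: fraction_neq0 b0 n0 ab.
have c0 : c != 0 by exact: fraction_neq0 e0 d0 ce.
exists (tofrac (a * e) / tofrac (b * c)).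
  by rewrite mulf_neq0 ?invr_eq0 ?tofrac_eq0 ?mulf_neq0.
rewrite (div_fraction O_finite_colength) ?mulf_neq0 //.
rewrite !(divisorM O_finite_colength) // raddfB.
rewrite /= (push_divisor n0 b0 ab) (push_divisor d0 e0 ce).
by rewrite opprB opprD addrACA.
Qed.

Lemma principal_push (y : {fraction O}) : y != 0 ->
  exists2 x : {fraction Ot}, x != 0 & push_forward (div x) = div y.
Proof.
rewrite -(fraction_repr y); set n := \n_(repr y); set d := \d_(repr y).
rewrite mulf_eq0 invr_eq0 !tofrac_eq0 negb_or => /andP [n0 d0].
exists (tofrac (to_norm n) / tofrac (to_norm d)).
  by rewrite mulf_neq0 ?invr_eq0 ?tofrac_eq0 ?to_norm_eq0.
rewrite (div_fraction norm_finite_colength) ?to_norm_eq0 // raddfB /=.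
by rewrite !push_divisor_to_norm // (div_fraction O_finite_colength).
Qed.

End PushDivisor.

(** * Fibres over invertible maximal ideals *)

Section EffectiveParts.
Variable A : idomainType.
Hypothesis fin : finite_colength A.

Lemma mi_covers (p : maxideal A) : covers (p : set A^o) setT.
Proof.
split; [exact: mi_submodule|exact: submoduleT| |].
  by split=> // /(_ 1 I); exact: mi_not1.
move=> L sL pL _; have [L1|L1] := pselect (L 1).
  right; apply/seteqP; split=> // x _.
  by rewrite -[x]mulr1; exact: subZ.
by left; apply: (mi_maximal p).2 => //; exact/proper_idealP.
Qed.

(** The factor [A / p] splits off at the top of [A / tA]. *)
Lemma divisor_mem (p : maxideal A) t : t != 0 -> (p : set A) t ->
  exists2 D : Div A, divisor t = D + << p >> &
    exists n, series (@ideal_div A) (principal_ideal t) n (p : set A^o) D.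
Proof.
move=> t0 pt; have [n sn] := divisor_cycle fin t0.
have tp : principal_ideal t `<=` p.
  by move=> _ [b _ <-]; exact: (subZ b (mi_submodule p)).
have [n1 [D [n2 [D2 [s1 s2]]]]] := series_interval sn (mi_submodule p) tp (@subsetT _ _).
exists D; last by exists n1.
have sp := series1 (@ideal_div A) (mi_covers p).
have [_ ->] := Jordan_Hoelder sn (series_cat s1 sp).
congr (_ + _); apply: ideal_div_covers => [|a pa x _]; first exact: mi_covers.
by rewrite /GRing.scale /= mulrC; exact: (subZ x (mi_submodule p)).
Qed.

End EffectiveParts.

Section InvertibleIdeals.
Variable A : idomainType.

Lemma gen_min (V : zmodType) (S H : set V) : is_subgroup H -> S `<=` H -> gen S `<=` H.
Proof. by move=> sH SH x; apply. Qed.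

Lemma sub_gen (V : zmodType) (S : set V) : S `<=` gen S.
Proof. by move=> x Sx H [_]; exact. Qed.

(** Some term of a relation [1 = u1 v1 + ... + un vn] with [ui] in [p] and
    [vi] in its inverse lies outside [p]; that term makes [ui] generate [p]
    locally at [p]. *)
Lemma invertible_uniformizer (p : maxideal A) : invertible p ->
  exists t s, [/\ (p : set A) t, ~ (p : set A) s &
    forall y, (p : set A) y -> exists c, s * y = c * t].
Proof.
move=> [J [_ pJ]].
have pJO u v : (p : set A) u -> J v -> exists c, tofrac u * v = tofrac c.
  move=> pu Jv; have : range (@FracField.tofrac A) (tofrac u * v).
    by rewrite -pJ; apply: sub_gen; exists (tofrac u), v; split=> //; exists u.
  by move=> [c _ <-]; exists c.
have [t [v [s [pt Jv tv ps]]]] : exists t v s,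
    [/\ (p : set A) t, J v, tofrac t * v = tofrac s & ~ (p : set A) s].
  apply: contrapT => nts.
  have : (@FracField.tofrac A @` p) 1.
    have : frac_mul (@FracField.tofrac A @` p) J 1 by rewrite pJ; exists 1 => //; exact: tofrac1.
    apply: gen_min.
      split; first by apply/mem_set; exists 0; [exact: sub0 (mi_submodule p)|exact: tofrac0].
      move=> x y /set_mem [u pu <-] /set_mem [w pw <-]; apply/mem_set.
      by exists (u - w); [exact: (subB (mi_submodule p))|rewrite tofracB].
    move=> _ [_ [v [[u pu <-] Jv ->]]]; have [c uv] := pJO u v pu Jv.
    by exists c => //; apply: contrapT => pc; apply: nts; exists u, v, c.
  move=> [u pu /eqP]; rewrite -tofrac1 tofrac_eq => /eqP u1.
  by apply: (@mi_not1 _ p); rewrite -u1.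
exists t, s; split=> // y /pJO /(_ Jv) [c yv]; exists c.
by apply/eqP; rewrite -tofrac_eq !tofracM -tv -yv mulrC mulrCA mulrC mulrAC.
Qed.

(** As [s] kills [p / tA], the only factor [A / p] of [A / tA] is the top one. *)
Lemma invertible_divisor (p : maxideal A) : finite_colength A ->
  (exists2 a, (p : set A) a & a != 0) -> invertible p ->
  exists t, [/\ (p : set A) t, t != 0 & coeff p (divisor t) = 1].
Proof.
move=> fin [a pa a0] /invertible_uniformizer [t [s [pt ps st]]].
have s0 : s != 0 by apply: contra_not_neq ps => ->; exact: (sub0 (mi_submodule p)).
have t0 : t != 0.
  apply/eqP => t0; have [c] := st a pa; rewrite t0 mulr0 => /eqP.
  by rewrite mulf_eq0 (negPf s0) (negPf a0).
exists t; split=> //; have [D -> [n sD]] := divisor_mem fin t0 pt.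
rewrite coeffD (cycle_killed sD ps); first by rewrite coeffU eqxx mul1r add0r.
by move=> y /st [c cE]; exists c; rewrite // cE.
Qed.

End InvertibleIdeals.

Section InvertibleFibre.
Variable O : idomainType.
Local Notation Ot := (normalization O).
Hypotheses (noethO : noetherian O) (dimO : krull_dim_eq O 1)
  (fgO : finitely_generated [set: (Ot : lmodType O)]).

Lemma coeff_push_forward q (D : Div Ot) : coeff q (push_forward D) =
  \sum_(P <- dom D) coeff P D * (res_degree P)%:Z * (contraction P == q)%:R.
Proof. by rewrite /push_forward raddf_sum; apply: eq_bigr => P _; exact: coeffU. Qed.

Lemma push_forward_ge0 q (D : Div Ot) :
  (forall P, (0 <= coeff P D)%R) -> (0 <= coeff q (push_forward D))%R.
Proof.
move=> D0; rewrite coeff_push_forward; apply: Num.Theory.sumr_ge0 => P _.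
by rewrite !Num.Theory.mulr_ge0 ?Num.Theory.ler0n.
Qed.

(** The remaining part of [D] has an effective push-forward. *)
Lemma push_forward_ge (P : maxideal Ot) (D : Div Ot) :
  (forall P, (0 <= coeff P D)%R) ->
  (coeff P D * (res_degree P)%:Z <= coeff (contraction P) (push_forward D))%R.
Proof.
move=> D0; have := @push_forward_ge0 (contraction P) (D - << coeff P D *g P >>).
rewrite raddfB /= push_forwardU coeffB coeffU eqxx mulr1 Num.Theory.subr_ge0.
apply=> P'; rewrite coeffB coeffU; case: eqVneq => [->|_].
  by rewrite mulr1 subrr.
by rewrite mulr0 subr0.
Qed.

(** A local equation of [p] at [p] has order 1 there, and this order is the
    sum over the [P] above [p] of the positive numbers
    [deg(P) * ord_P(t)]. *)
Lemma invertible_fibre (p : maxideal O) : invertible p ->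
  exists P, [/\ contraction P = p, res_degree P = 1%N &
    forall P', contraction P' = p -> P' = P].
Proof.
move=> ip.
have finO := O_finite_colength noethO dimO.
have finOt := norm_finite_colength noethO dimO fgO.
have [t [pt t0 pt1]] := invertible_divisor finO (mi_nonzero dimO p) ip.
have tt0 : to_norm t != 0 by rewrite to_norm_eq0.
have pushE := push_divisor_to_norm noethO dimO fgO t0.
have [P Pp] : exists P, contraction P = p.
  apply: contrapT => nP; have := pt1; rewrite -pushE coeff_push_forward big1 //.
  by move=> P _; case: eqP => [E|_]; [case: nP; exists P|rewrite mulr0].
have split P1 : contraction P1 = p -> exists2 D, divisor (to_norm t) = D + << P1 >> &
    forall P2, (0 <= coeff P2 D)%R.
  move=> P1p; have Pt : (P1 : set Ot) (to_norm t) by rewrite -P1p in pt.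
  have [D DE [n sD]] := divisor_mem finOt tt0 Pt.
  by exists D => // P2; exact: cycle_ge0 sD.
have [D DE D0] := split P Pp.
have : coeff p (push_forward D) + (res_degree P)%:Z = 1.
  by rewrite -pt1 -pushE DE raddfD /= coeffD push_forwardU mul1r coeffU Pp eqxx mulr1.
have := push_forward_ge0 p D0; have := res_degree_gt0 noethO dimO fgO P.
case degP: (res_degree P) => [|k] // _.
case pD : (coeff p _) => [m|//] _ mk.
have {mk} : (m + k.+1)%N = 1%N by case: mk.
rewrite addnS => -[/eqP]; rewrite addn_eq0 => /andP [/eqP m0 /eqP k0].
exists P; split=> //; first by rewrite degP k0.
move=> P' P'p; apply: contrapT => P'P.
have := push_forward_ge P' D0; rewrite P'p pD m0.
have [D' D'E D'0] := split P' P'p.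
have -> : coeff P' D = coeff P' D' + 1.
  have : coeff P' (D + << P >>) = coeff P' (D' + << P' >>) by rewrite -DE -D'E.
  rewrite !coeffD !coeffU eqxx mulr1.
  by case: eqP => [E|_]; [case: P'P|rewrite mulr0 addr0].
apply/negP; rewrite -Order.TotalTheory.ltNge; apply: Num.Theory.mulr_gt0.
  by apply: Num.Theory.ltr_wpDl; rewrite ?Num.Theory.ltr01.
by rewrite ltz_nat; exact: res_degree_gt0.
Qed.

End InvertibleFibre.

(** * Quotients by generated subgroups *)

Section QuotientGroups.
Variables (U W : zmodType).

HB.instance Definition _ (S : set U) := GRing.isZmodMorphism.Build U (quotg S) (@cls U S)
  (raddfB \pi_(quotg S)%qT).

Lemma clsP (S : set U) x y : cls S x = cls S y <-> gen S (x - y).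
Proof.
rewrite /cls; split=> [/eqP|h]; last apply/eqP; rewrite -Quotient.idealrBE.
  exact: set_mem.
exact: mem_set.
Qed.

Lemma cls_eq0 (S : set U) x : cls S x = 0 <-> gen S x.
Proof. by rewrite -[in gen S x](subr0 x) -clsP raddf0. Qed.

Lemma cls_surj (S : set U) (y : quotg S) : exists x, y = cls S x.
Proof. by exists (repr y); rewrite /cls reprK. Qed.

Lemma ker_subgroup (f : {additive U -> W}) : is_subgroup (ker f).
Proof.
split; first by apply/mem_set; rewrite /ker /= raddf0.
by move=> x y /set_mem fx /set_mem fy; apply/mem_set; rewrite /ker /= raddfB fx fy subr0.
Qed.

Lemma quotg_lift (S : set U) (f : {additive U -> W}) : S `<=` ker f ->
  exists fbar : {additive quotg S -> W}, forall x, fbar (cls S x) = f x.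
Proof.
move=> Sf; pose g (y : quotg S) := f (repr y).
have gE x : g (cls S x) = f x.
  apply/eqP; rewrite -subr_eq0 -raddfB; apply/eqP.
  apply: (gen_min (ker_subgroup f) Sf); apply/clsP.
  by rewrite /cls reprK.
have g_zmod : zmod_morphism g.
  move=> y z; have [x ->] := cls_surj y; have [x' ->] := cls_surj z.
  by rewrite -raddfB !gE raddfB.
exists (HB.pack_for {additive quotg S -> W} g
  (GRing.isZmodMorphism.Build (quotg S) W g g_zmod)).
exact: gE.
Qed.

Lemma first_isomorphism (S : set U) (f : {additive U -> W}) :
  range f = setT -> ker f = S -> exists psi : {additive quotg S -> W}, bijective psi.
Proof.
move=> fT fS; have [|psi psiE] := @quotg_lift S f; first by rewrite fS.
have inv y : exists x, psi x = y.
  have : range f y by rewrite fT.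
  by move=> [x _ <-]; exists (cls S x).
have [g gP] := choice inv; exists psi; exists g => // x.
have [u ->] := cls_surj x; have [v gv] := cls_surj (g (psi (cls S u))).
have := gP (psi (cls S u)); rewrite gv !psiE => /eqP; rewrite -subr_eq0 -raddfB => /eqP h.
apply/clsP; apply: sub_gen; have : ker f (v - u) by [].
by rewrite fS.
Qed.

End QuotientGroups.

Section Generators.
Variable V : zmodType.
Implicit Types S : set V.

Lemma gen0 S : gen S 0.
Proof. exact/set_mem/(rpred0 (gen_pred S)). Qed.

Lemma genB S x y : gen S x -> gen S y -> gen S (x - y).
Proof. by move=> /mem_set Sx /mem_set Sy; apply/set_mem/(rpredB (S := gen_pred S)). Qed.

Lemma genMz S x (m : int) : gen S x -> gen S (x *~ m).
Proof. by move=> /mem_set Sx; apply/set_mem/(rpredMz (S := gen_pred S)). Qed.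

Lemma gen_sum S (I : finType) (F : I -> V) :
  (forall i, gen S (F i)) -> gen S (\sum_i F i).
Proof.
by move=> SF; apply/set_mem/(rpred_sum (S := gen_pred S)) => i _; exact/mem_set.
Qed.

End Generators.

(** * The kernel of the push-forward *)

Section Kernel.
Variable O : idomainType.
Local Notation Ot := (normalization O).
Hypotheses (noethO : noetherian O) (dimO : krull_dim_eq O 1)
  (fgO : finitely_generated [set: (Ot : lmodType O)]).
Variables (r : nat) (p : 'I_r -> maxideal O).
Hypothesis p_inj : injective p.
Hypothesis pP : range p = [set q | ~ invertible q].
Variables (s : 'I_r -> nat) (P : forall i, 'I_(s i) -> maxideal Ot).
Arguments P : clear implicits.
Hypothesis P_inj : forall i, injective (P i).
Hypothesis PP : forall i, range (P i) = [set Q | contraction Q = p i].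
Variable lambda : forall i, 'I_(s i) -> int.
Arguments lambda : clear implicits.
Local Notation d i j := (res_degree (P i j)).
Local Notation g i := (\big[gcdn/0%N]_(j < s i) d i j).
Hypothesis bezout : forall i, (g i)%:Z = \sum_(j < s i) lambda i j * (d i j)%:Z.
Local Notation Q i := (\sum_(j < s i) << lambda i j *g P i j >> : Div Ot).

Definition kernel_generators : set (Div Ot) := [set D | exists i (j : 'I_(s i)),
  D = Q i *+ (d i j %/ g i)%N - << P i j >>].

Lemma contractionP i j : contraction (P i j) = p i.
Proof. by have : range (P i) (P i j) by []; rewrite PP. Qed.

Lemma gcd_dvd i (j : 'I_(s i)) : (g i %| d i j)%N.
Proof. by rewrite (bigD1 j) //=; exact: dvdn_gcdl. Qed.

(** As degrees are positive, [g i = 0] means that the family of the [P i j] is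
    empty. *)
Lemma gcd_eq0 i : g i = 0%N -> Q i = 0.
Proof.
move=> gi0; rewrite big1 // => j _; have := gcd_dvd j.
by rewrite gi0 dvd0n => /eqP d0; have := res_degree_gt0 noethO dimO fgO (P i j); rewrite d0.
Qed.

Lemma push_Q i : push_forward (Q i) = << p i >> *+ g i.
Proof.
rewrite raddf_sum /= freegU_muln natz bezout.
rewrite (eq_bigr (fun j => << lambda i j * (d i j)%:Z *g p i >>)); last first.
  by move=> j _; rewrite push_forwardU contractionP.
apply/eqP/freeg_eqP => q; rewrite raddf_sum coeffU mulr_suml.
by apply: eq_bigr => j _; exact: coeffU.
Qed.

Lemma push_kernel_generators : kernel_generators `<=` ker (@push_forward O).
Proof.
move=> _ [i [j ->]]; rewrite /ker /= raddfB raddfMn /= push_Q push_forwardU.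
by rewrite contractionP mul1r -natz -freegU_muln -mulrnA mulnC divnK ?gcd_dvd // subrr.
Qed.

Lemma coeff_push_invertible q Q' (D : Div Ot) : contraction Q' = q ->
  res_degree Q' = 1%N -> (forall Q'', contraction Q'' = q -> Q'' = Q') ->
  coeff q (push_forward D) = coeff Q' D.
Proof.
move=> Q'q d1 uQ'; rewrite -[in RHS](freeg_sumE D) coeff_push_forward raddf_sum.
apply: eq_bigr => Q'' _ /=; rewrite coeffU; case: (eqVneq Q'' Q') => [->|nQ].
  by rewrite Q'q eqxx d1 mulr1.
by case: eqP => [/uQ' E|]; [rewrite E eqxx in nQ|rewrite !mulr0].
Qed.

(** Over an invertible maximal ideal [D] has a single coefficient, which is also
    that of its push-forward. *)
Lemma fibre_decomposition (D : Div Ot) :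
  (forall q, invertible q -> coeff q (push_forward D) = 0) ->
  D = \sum_i \sum_(j < s i) << coeff (P i j) D *g P i j >>.
Proof.
move=> D0; apply/eqP/freeg_eqP => Q'; rewrite raddf_sum.
have sumE i : coeff Q' (\sum_(j < s i) << coeff (P i j) D *g P i j >> : Div Ot) =
    \sum_(j < s i) coeff (P i j) D * (P i j == Q')%:R.
  by rewrite raddf_sum; apply: eq_bigr => j _; exact: coeffU.
rewrite (eq_bigr _ (fun i _ => sumE i)).
have [[i iE]|ni] := pselect (exists i, contraction Q' = p i); last first.
  rewrite [RHS]big1 => [|i _]; last first.
    rewrite big1 // => j _; case: eqP => [E|_]; last by rewrite mulr0.
    by case: ni; exists i; rewrite -E contractionP.
  have ip : invertible (contraction Q').
    apply: contrapT => np; have : range p (contraction Q') by rewrite pP.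
    by move=> [i _ E]; apply: ni; exists i.
  have [P' [P'E d1 uP']] := invertible_fibre noethO dimO fgO ip.
  by rewrite (uP' Q' erefl) -(coeff_push_invertible D P'E d1 uP') D0.
have [j _ jE] : range (P i) Q' by rewrite PP.
rewrite (bigD1 i) //= [X in _ + X]big1 ?addr0 => [|i' ii']; last first.
  rewrite big1 // => j' _; case: eqP => [E|_]; last by rewrite mulr0.
  by case/eqP: ii'; apply: p_inj; rewrite -(contractionP j') E.
rewrite (bigD1 j) //= [X in _ + X]big1 ?addr0 => [|j' jj'].
  by rewrite jE eqxx mulr1.
by rewrite -jE (inj_eq (@P_inj i)) (negPf jj') mulr0.
Qed.

(** Modulo the generators, [P i j] equals [Q i] times [d i j / g i]; this
    replaces the components over [p i] by a single multiple of [Q i]. *)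
Lemma kernel_reduction (D : Div Ot) :
  (forall q, invertible q -> coeff q (push_forward D) = 0) ->
  exists2 m : 'I_r -> int,
    gen kernel_generators (D - \sum_i Q i *~ m i) &
    push_forward D = \sum_i (<< p i >> *+ g i) *~ m i.
Proof.
move=> D0; pose c i j := coeff (P i j) D.
pose m i := \sum_(j < s i) c i j * (d i j %/ g i)%N%:Z.
have DE : D - \sum_i Q i *~ m i =
    \sum_i \sum_(j < s i) (Q i *+ (d i j %/ g i)%N - << P i j >>) *~ (- c i j).
  rewrite {1}(fibre_decomposition D0) -sumrB; apply: eq_bigr => i _.
  rewrite /m mulrz_sumr -sumrB; apply: eq_bigr => j _.
  rewrite mulrNz mulrzBl opprB freegU_mulz; congr (_ - _).
    by rewrite intz.
  by rewrite pmulrn -mulrzA mulrC.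
have gD : gen kernel_generators (D - \sum_i Q i *~ m i).
  rewrite DE; apply: gen_sum => i; apply: gen_sum => j; apply: genMz.
  by apply: sub_gen; exists i, j.
exists m => //.
have := gen_min (ker_subgroup (@push_forward O)) push_kernel_generators gD.
rewrite /ker /= raddfB => /eqP; rewrite subr_eq0 => /eqP ->; rewrite raddf_sum.
by apply: eq_bigr => i _; rewrite raddfMz /= push_Q.
Qed.

End Kernel.

(** * The Chow group *)

Lemma range_push_principal (O : idomainType) (noethO : noetherian O)
    (dimO : krull_dim_eq O 1)
    (fgO : finitely_generated [set: (normalization O : lmodType O)]) :
  gen (@principal O) =
  [set push_forward E | E in gen (@principal (normalization O))].
Proof.
apply/seteqP; split; last first.
  move=> _ [E + <-]; apply: (@gen_min _ _ [set E | gen _ (push_forward E)]).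
    split; first by apply/mem_set; rewrite /= raddf0; exact: gen0.
    by move=> x y /set_mem gx /set_mem gy; apply/mem_set; rewrite /= raddfB; exact: genB.
  move=> _ [x x0 <-]; have [y y0 /= ->] := push_principal noethO dimO fgO x0.
  by apply: sub_gen; exists y.
apply: gen_min.
  split; first by apply/mem_set; exists 0; [exact: gen0|exact: raddf0].
  move=> _ _ /set_mem [E gE <-] /set_mem [F gF <-]; apply/mem_set.
  by exists (E - F); [exact: genB|exact: raddfB].
move=> _ [y y0 <-]; have [x x0 xy] := principal_push noethO dimO fgO y0.
by exists (div x) => //; apply: sub_gen; exists x.
Qed.

Lemma pair_additive (U V W : zmodType) (f : {additive U -> W}) (g : {additive V -> W}) :
  exists phi : {additive (U * V)%type -> W}, forall x, phi x = f x.1 + g x.2.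
Proof.
pose phi (x : U * V) := f x.1 + g x.2.
have phi_zmod : zmod_morphism phi.
  by move=> x y; rewrite /phi /= !raddfB opprD addrACA.
by exists (HB.pack_for {additive (U * V)%type -> W} phi
  (GRing.isZmodMorphism.Build (U * V)%type W phi phi_zmod)).
Qed.

Lemma coeff_fibres (O : idomainType) r (p : 'I_r -> maxideal O) (k : 'I_r -> nat)
    (m : 'I_r -> int) i : injective p ->
  coeff (p i) (\sum_j (<< p j >> *+ k j) *~ m j : Div O) = (k i)%:R *~ m i.
Proof.
move=> p_inj; rewrite raddf_sum (bigD1 i) //= [X in _ + X]big1 => [|j ji].
  by rewrite freegU_muln freeg_mulz coeffU eqxx mulr1 addr0.
by rewrite freegU_muln freeg_mulz coeffU (inj_eq p_inj) (negPf ji) mulr0.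
Qed.

Lemma pair_sum_mulz (U V : zmodType) r (u : 'I_r -> U) (v : 'I_r -> V)
    (m : 'I_r -> int) :
  \sum_i (u i, v i) *~ m i = (\sum_i u i *~ m i, \sum_i v i *~ m i).
Proof.
apply: injective_projections; rewrite ?(raddf_sum fst) ?(raddf_sum snd) /=.
  by apply: eq_bigr => i _; exact: (raddfMz fst).
by apply: eq_bigr => i _; exact: (raddfMz snd).
Qed.

Lemma sg_val_sum (V : zmodType) (S : set V) r (z : 'I_r -> subgrp S)
    (k : 'I_r -> nat) (m : 'I_r -> int) :
  sg_val (\sum_i (z i *+ k i) *~ m i) = \sum_i (sg_val (z i) *+ k i) *~ m i.
Proof.
rewrite [LHS](raddf_sum (val : subgrp S -> V)); apply: eq_bigr => i _.
rewrite [LHS](raddfMz (val : subgrp S -> V)); congr (_ *~ _).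
exact: (raddfMn (val : subgrp S -> V)).
Qed.

Lemma raddf_sum_mulz (U V : zmodType) (f : {additive U -> V}) r (u : 'I_r -> U)
    (m : 'I_r -> int) :
  f (\sum_i u i *~ m i) = \sum_i f (- u i) *~ (- m i).
Proof.
rewrite raddf_sum; apply: eq_bigr => i _.
by rewrite raddfMz raddfN mulrNz mulNrz opprK.
Qed.

Theorem theorem2p7 (O : idomainType)
    (noethO : noetherian O) (dimO : krull_dim_eq O 1)
    (fgO : finitely_generated [set: (normalization O : lmodType O)])
    (r : nat) (p : 'I_r -> maxideal O) (p_inj : injective p)
    (pP : range p = [set q | ~ invertible q])
    (s : 'I_r -> nat) (P : forall i, 'I_(s i) -> maxideal (normalization O))
    (P_inj : forall i, injective (P i))
    (PP : forall i, range (P i) = [set Q | contraction Q = p i])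
    (lambda : forall i, 'I_(s i) -> int) :
  let d i (j : 'I_(s i)) := res_degree (P i j) in
  let g i := \big[gcdn/0%N]_(j < s i) d i j in
  (forall i, (g i)%:Z = \sum_(j < s i) lambda i j * (d i j)%:Z) ->
  let Q i : Div (normalization O) := \sum_(j < s i) << lambda i j *g P i j >> in
  (ker (@push_forward O) =
     gen [set D | exists i (j : 'I_(s i)),
            D = Q i *+ (d i j %/ g i)%N - << P i j >>]) /\
  exists fbar : {additive Chow (normalization O) -> Chow O},
    (forall D, fbar (cls _ D) = cls _ (push_forward D)) /\
    let Zp := subgrp [set D : Div O | exists i, D = << p i >>] in
    let G : zmodType := (Zp * quotg (ker fbar))%type in
    let R : set G := gen [set x | exists i,
       sg_val x.1 = << p i >> *+ g i /\ x.2 = cls _ (cls _ (- Q i))] in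
    (exists phi : {additive G -> Chow O},
      [/\ forall (a : Zp) (A : Div (normalization O)),
            phi (a, cls _ (cls _ A)) = cls _ (sg_val a + push_forward A),
          range phi = [set: Chow O] &
          ker phi = R]) /\
    (exists psi : {additive quotg R -> Chow O}, bijective psi).
Proof.
move=> d g bezout Q.
set S := [set D | _].
have reduction D : (forall q, invertible q -> coeff q (push_forward D) = 0) ->
    exists2 m : 'I_r -> int, gen S (D - \sum_i Q i *~ m i) &
      push_forward D = \sum_i (<< p i >> *+ g i) *~ m i.
  exact: (kernel_reduction noethO dimO fgO p_inj pP P_inj PP bezout).
have Q0 i : g i = 0%N -> Q i = 0 by move=> /(gcd_eq0 noethO dimO fgO); exact.
have pushQ i : push_forward (Q i) = << p i >> *+ g i by exact: push_Q.
have kerE : ker (@push_forward O) = gen S.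
  apply/seteqP; split=> [D|].
    rewrite {1}/ker /= => D0; have [|m gm mE] := reduction D; first by move=> q _; rewrite D0 coeff0.
    suff -> : D = D - \sum_i Q i *~ m i by exact: gm.
    rewrite [X in _ - X]big1 ?subr0 // => i _.
    have : coeff (p i) (push_forward D) = 0 by rewrite D0 coeff0.
    (* [m i * g i] vanishes, hence [m i] or [Q i] does. *)
    rewrite mE (coeff_fibres _ _ _ p_inj) => /eqP.
    rewrite mulrz_eq0 => /orP [/eqP ->|]; first by rewrite mulr0z.
    by rewrite Num.Theory.pnatr_eq0 => /eqP /Q0 ->; rewrite mul0rz.
  apply: gen_min; first exact: ker_subgroup.
  exact: (push_kernel_generators PP bezout).
split=> //.
have principalE := range_push_principal noethO dimO fgO.
have [|fbar fbarE] := @quotg_lift _ _ (@principal (normalization O))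
    (@cls _ (@principal O) \o @push_forward O).
  move=> D gD; apply/cls_eq0; rewrite principalE.
  by exists D => //; exact: sub_gen.
exists fbar; split; first exact: fbarE.
move=> Zp G R.
have [|fbar2 fbar2E] := @quotg_lift _ _ (ker fbar) fbar; first by [].
have [phi phiE] := pair_additive (@cls _ (@principal O) \o (val : Zp -> Div O)) fbar2.
have phiP (a : Zp) (A : Div (normalization O)) :
    phi (a, cls _ (cls _ A)) = cls _ (sg_val a + push_forward A).
  by rewrite phiE /= fbar2E fbarE /= raddfD.
have ZpE i : exists z : Zp, sg_val z = << p i >>.
  have zP : << p i >> \in gen_pred [set D : Div O | exists i, D = << p i >>].
    by apply: mem_set; apply: sub_gen; exists i.
  by exists (Subgrp zP).
have phiT : range phi = [set: Chow O].
  apply/seteqP; split=> // y _; have [D ->] := cls_surj y.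
  suff [a [A ->]] : exists (a : Zp) A, D = sg_val a + push_forward A.
    by exists (a, cls _ (cls _ A)); rewrite ?phiP.
  rewrite -(freeg_sumE D).
  apply: (big_ind (fun D => exists (a : Zp) A, D = sg_val a + push_forward A)).
  - by exists 0, 0; rewrite raddf0 addr0; exact/esym/(raddf0 (val : Zp -> Div O)).
  - move=> _ _ [a [A ->]] [a' [A' ->]]; exists (a + a'), (A + A').
    by rewrite raddfD addrACA; congr (_ + _); exact/esym/(raddfD (val : Zp -> Div O)).
  move=> q _; have [iq|niq] := pselect (invertible q).
    have [P' [P'q d1 _]] := invertible_fibre noethO dimO fgO iq.
    exists 0, << coeff q D *g P' >>; rewrite push_forwardU d1 mulr1 P'q.
    by rewrite [X in X + _](raddf0 (val : Zp -> Div O)) add0r.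
  have [i _ pi] : range p q by rewrite pP.
  have [z zE] := ZpE i; exists (z *~ coeff q D), 0.
  rewrite raddf0 addr0 [RHS](raddfMz (val : Zp -> Div O)) /= zE pi.
  by rewrite freegU_mulz intz.
have kerphi : ker phi = R.
  apply/seteqP; split; last first.
    apply: gen_min; first exact: ker_subgroup.
    move=> [a y] [i /= [aE ->]]; rewrite /ker /= phiP aE raddfN /= pushQ subrr.
    exact: (raddf0 (@cls _ (@principal O))).
  move=> [a y]; have [y' ->] := cls_surj y; have [A ->] := cls_surj y'.
  rewrite {1}/ker /= phiP => /cls_eq0; rewrite principalE => -[E gE EE].
  have pushD : push_forward (A - E) = - sg_val a.
    by rewrite raddfB /= EE opprD addrCA subrr addr0.
  (* [a] lives on the [p i], so the kernel reduction applies to [A - E]. *)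
  have [q iq|m gm mE] := reduction (A - E).
    rewrite pushD coeffN; apply/eqP; rewrite oppr_eq0; apply/eqP.
    apply: (@gen_min _ _ [set D : Div O | coeff q D = 0]) (set_mem (valP a)).
      split; first by apply/mem_set; exact: coeff0.
      by move=> u v /set_mem /= u0 /set_mem /= v0; apply/mem_set; rewrite /= coeffB u0 v0 subr0.
    move=> _ [i ->] /=; rewrite coeffU; case: eqP => // pi.
    have : range p q by exists i.
    by rewrite pP.
  have [z zP] := choice ZpE.
  have aE : a = \sum_i (z i *+ g i) *~ (- m i).
    apply: val_inj; rewrite [RHS]sg_val_sum -[LHS]opprK -pushD mE -sumrN.
    by apply: eq_bigr => i _; rewrite zP mulrNz.
  have AE : cls (ker fbar) (cls _ A) = \sum_i cls _ (cls _ (- Q i)) *~ (- m i).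
    rewrite -(raddf_sum_mulz (@cls _ (ker fbar) \o @cls _ (@principal _)) Q) /=.
    apply/clsP; apply: sub_gen; rewrite /ker /= -raddfB fbarE /=.
    apply/cls_eq0; rewrite principalE; exists E => //.
    apply/esym/eqP; rewrite -subr_eq0 -raddfB addrAC; apply/eqP.
    by move: gm; rewrite -kerE.
  rewrite aE AE -pair_sum_mulz; apply: gen_sum => i; apply: genMz; apply: sub_gen.
  by exists i; split=> //=; rewrite -zP; exact: (raddfMn (val : Zp -> Div O)).
split; first by exists phi.
exact: first_isomorphism phiT kerphi.
Qed.
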